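(* Let $f_\mu\colon X\to X$, $\mu\in\mathbb{R}^\ell$, be the piecewise-affine contractions defined in the context. Then for Lebesgue almost every $\mu\in\mathbb{R}^\ell$, $f_\mu$ is asymptotically periodic on $Z_\mu$.
   Context: $X\subset\mathbb{R}^d$ is a compact convex polytope (the intersection of finitely many closed half-spaces; it need not be full-dimensional), $\mathrm{relint}(X)$ its relative interior (interior relative to its affine hull). Let $\ell\ge1$, $\mathcal{A}=\{-1,1\}^\ell$, and for each $i\in\mathcal{A}$ let $\varphi_i(x)=\Lambda_ix+b_i$ with $\Lambda_i\in GL_d(\mathbb{R})$, $b_i\in\mathbb{R}^d$, $\|\Lambda_i\|<1$ in the operator norm induced by some (fixed) norm on $\mathbb{R}^d$, and $\varphi_i(X)\subset\mathrm{relint}(X)$. Let $v^{(1)},\dots,v^{(\ell)}\in\mathbb{R}^d$ be unit vectors and for $\mu=(\mu_1,\dots,\mu_\ell)\in\mathbb{R}^\ell$ let $H_j(\mu)=\{x:\langle v^{(j)},x\rangle=\mu_j\}$. The label map $\sigma_\mu\colon\mathbb{R}^d\to\mathcal{A}$ is $\sigma_\mu(x)=(s_1(x),\dots,s_\ell(x))$ with $s_j(x)=-1$ if $\langle v^{(j)},x\rangle\le\mu_j$ and $s_j(x)=1$ otherwise. Define $f_\mu(x)=\varphi_{\sigma_\mu(x)}(x)$ for $x\in X$. Its partition is $A_{i,\mu}=\mathrm{relint}(X)\cap\mathrm{relint}(\{x\in X:\sigma_\mu(x)=i\})$, $i\in\mathcal{A}$, and its singular set is $S_\mu=X\setminus\bigcup_iA_{i,\mu}$.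 $Z_\mu$ is the set of $x\in X$ with $f_\mu^n(x)\notin S_\mu$ for all $n\ge0$ (regular points). For a forward invariant $Y$, $f$ is asymptotically periodic on $Y$ if $\bigcup_{x\in Y}\omega(f,x)$ is a union of finitely many periodic orbits, where $\omega(f,x)=\bigcap_{m\ge1}\overline{\bigcup_{n\ge m}\{f^n(x)\}}$. *)

(* Defs.v *)
From HB Require Import structures.
From mathcomp Require Import all_boot all_order all_algebra.
From mathcomp Require Import all_classical all_reals all_analysis.
Set Implicit Arguments. Unset Strict Implicit. Unset Printing Implicit Defensive.
Import numFieldNormedType.Exports.
Import Order.TTheory GRing.Theory Num.Theory.
Local Open Scope classical_set_scope.
Local Open Scope ring_scope.

Definition dotv {R : realType} {d : nat} (u x : 'cV[R]_d) : R :=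
  \sum_(k < d) u k 0 * x k 0.

Definition is_Hpolyhedron {R : realType} {d : nat} (X : set 'cV[R]_d) : Prop :=
  exists (m : nat) (a : 'I_m -> 'cV[R]_d) (beta : 'I_m -> R),
    X = [set x | forall k, dotv (a k) x <= beta k].

Definition affine_set {R : realType} {d : nat} (A : set 'cV[R]_d) : Prop :=
  forall x y (t : R), A x -> A y -> A ((1 - t) *: x + t *: y).

Definition aff_hull {R : realType} {d : nat} (S : set 'cV[R]_d) : set 'cV[R]_d :=
  \bigcap_(A in [set A | affine_set A /\ S `<=` A]) A.

Definition relint {R : realType} {d : nat} (S : set 'cV[R]_d) : set 'cV[R]_d :=
  [set x | S x /\ exists U, nbhs x U /\ U `&` aff_hull S `<=` S].

Definition is_norm {R : realType} {d : nat} (N : 'cV[R]_d -> R) : Prop :=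
  [/\ forall x, N x = 0 -> x = 0,
      forall x y, N (x + y) <= N x + N y &
      forall (a : R) x, N (a *: x) = `|a| * N x].

Definition op_norm {R : realType} {d : nat} (N : 'cV[R]_d -> R) (M : 'M[R]_d) : R :=
  sup [set N (M *m x) | x in [set x | N x <= 1]].

(* the alphabet {-1,1}^l, encoded by booleans: true <-> +1, false <-> -1 *)
Definition alphabet (l : nat) := {ffun 'I_l -> bool}.

Definition label {R : realType} {d l : nat} (v : 'I_l -> 'cV[R]_d) (mu : 'I_l -> R)
  (x : 'cV[R]_d) : alphabet l :=
  [ffun j => mu j < dotv (v j) x].

Definition phi {R : realType} {d l : nat} (Lam : alphabet l -> 'M[R]_d)
  (b : alphabet l -> 'cV[R]_d) (i : alphabet l) (x : 'cV[R]_d) : 'cV[R]_d :=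
  Lam i *m x + b i.

Definition fmu {R : realType} {d l : nat} (Lam : alphabet l -> 'M[R]_d)
  (b : alphabet l -> 'cV[R]_d) (v : 'I_l -> 'cV[R]_d) (mu : 'I_l -> R)
  (x : 'cV[R]_d) : 'cV[R]_d :=
  phi Lam b (label v mu x) x.

Definition partA {R : realType} {d l : nat} (X : set 'cV[R]_d)
  (v : 'I_l -> 'cV[R]_d) (mu : 'I_l -> R) (i : alphabet l) : set 'cV[R]_d :=
  relint X `&` relint [set x | X x /\ label v mu x = i].

Definition singular_set {R : realType} {d l : nat} (X : set 'cV[R]_d)
  (v : 'I_l -> 'cV[R]_d) (mu : 'I_l -> R) : set 'cV[R]_d :=
  X `\` \bigcup_(i in [set: alphabet l]) partA X v mu i.

Definition regular_set {R : realType} {d l : nat} (X : set 'cV[R]_d)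
  (Lam : alphabet l -> 'M[R]_d) (b : alphabet l -> 'cV[R]_d)
  (v : 'I_l -> 'cV[R]_d) (mu : 'I_l -> R) : set 'cV[R]_d :=
  [set x | X x /\ forall n : nat, ~ singular_set X v mu (iter n (fmu Lam b v mu) x)].

Definition omega_limit {T : topologicalType} (f : T -> T) (x : T) : set T :=
  \bigcap_(m in [set m : nat | (1 <= m)%N])
    closure [set iter n f x | n in [set n : nat | (m <= n)%N]].

Definition orbit_set {T : Type} (f : T -> T) (p : T) : set T :=
  [set iter n f p | n in [set: nat]].

Definition asymptotically_periodic {T : topologicalType} (f : T -> T) (Y : set T) : Prop :=
  exists (k : nat) (p : 'I_k -> T) (per : 'I_k -> nat),
    (forall r, (0 < per r)%N /\ iter (per r) f (p r) = p r) /\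
    \bigcup_(x in Y) omega_limit f x =
    \bigcup_(r in [set: 'I_k]) orbit_set f (p r).

Definition lebesgue_null {R : realType} {l : nat} (E : set ('I_l -> R)) : Prop :=
  forall eps : R, 0 < eps ->
    exists a bb : nat -> 'I_l -> R,
      (forall n j, a n j <= bb n j) /\
      E `<=` \bigcup_(n in [set: nat]) [set mu | forall j, a n j <= mu j <= bb n j] /\
      (forall K : nat, \sum_(n < K) \prod_(j < l) (bb n j - a n j) <= eps).

(* Main.v *)
(* Words [w] in the alphabet act on points by compositions [Phi w] of the maps
   [phi i], which do not depend on [mu]. Call [w] realized by [x] if every point of
   the orbit of [x] along [w] lies in the closed cell named by the next letter.

   For all [mu] outside a countable union of hyperplanes, the linear equations
   "the orbit of [x] along [w] meets H_j at time k" have dependent left-hand sides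
   only if the right-hand sides [mu_j] satisfy the same dependency. A linear map
   then sends each left-hand side (v_j)^T Lam_w to the unit vector e_j. As
   (v_j)^T Lam_w tends to 0, a sufficiently late hit cannot lie in the span of the
   earlier ones; it raises the rank, which is at most d. Hence hits have density
   zero along every word. Since realized words branch only at hits, and since a
   contraction keeps small sets small, the number of realized words of length n
   grows subexponentially.

   Realizability is a closed condition, so this bound is locally uniform in [mu].
   If arbitrarily long realized words [w] have [Phi w X] meeting a hyperplane, then
   some [mu_j] lies in one of subexponentially many intervals of length O(lam^n),
   which has measure zero. For the other [mu], labels are constant on the sets
   [Phi w X] with [w] realized of some fixed length n, so n consecutive labels
   determine the future itinerary; itineraries are eventually periodic and orbits
   converge to one of finitely many cycles. *)
Require Import Defs.
From HB Require Import structures.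
From mathcomp Require Import all_boot all_order all_algebra.
From mathcomp Require Import all_classical all_reals all_analysis.
From mathcomp Require Import zify ring lra.
Import numFieldNormedType.Exports.
Import Order.TTheory GRing.Theory Num.Theory.
Local Open Scope classical_set_scope.
Local Open Scope ring_scope.
Set Implicit Arguments. Unset Strict Implicit. Unset Printing Implicit Defensive.

Lemma near_dist_le (R : realType) (V : normedModType R) (x : V) (e : R) :
  0 < e -> \forall y \near x, `|x - y| <= e.
Proof.
by move=> e0; apply/nbhs_ballP; exists e => //= y; rewrite -ball_normE => /ltW.
Qed.

(** * Norms on column vectors *)

Section Norm.
Context {R : realType} {d : nat}.
Implicit Types (x y : 'cV[R]_d) (M : 'M[R]_d).

Lemma mxnorm_entry m n (A : 'M[R]_(m, n)) i j : `|A i j| <= `|A|.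
Proof.
rewrite [leRHS]/Num.Def.normr/= mx_normrE.
by apply/bigmax_geP; right => /=; exists (i, j).
Qed.

Lemma mxnorm_le m n (A : 'M[R]_(m, n)) (e : R) :
  0 <= e -> (forall i j, `|A i j| <= e) -> `|A| <= e.
Proof.
by move=> e0 Ae; rewrite [leLHS]/Num.Def.normr/= mx_normrE (bigmax_le _ e0).
Qed.

Lemma mxnorm_tr m n (A : 'M[R]_(m, n)) : `|A^T| = `|A|.
Proof.
by apply/le_anti/andP; split; apply: mxnorm_le => // i j;
  [rewrite mxE | rewrite -[A i j](mxE trmx_key (fun i j => A j i))];
  exact: mxnorm_entry.
Qed.

Variable N : 'cV[R]_d -> R.
Hypothesis hN : is_norm N.

Lemma normD x y : N (x + y) <= N x + N y. Proof. by case: hN. Qed.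

Lemma normZ a x : N (a *: x) = `|a| * N x. Proof. by case: hN. Qed.

Lemma norm0 : N 0 = 0.
Proof. by rewrite -(scale0r (0 : 'cV[R]_d)) normZ normr0 mul0r. Qed.

Lemma normN x : N (- x) = N x.
Proof. by rewrite -scaleN1r normZ normrN1 mul1r. Qed.

Lemma norm_ge0 x : 0 <= N x.
Proof. by have := normD x (- x); rewrite subrr norm0 normN; lra. Qed.

Lemma norm_distC x y : N (x - y) = N (y - x).
Proof. by rewrite -normN opprB. Qed.

Lemma norm_dist_trans y x z : N (x - z) <= N (x - y) + N (y - z).
Proof. by have := normD (x - y) (y - z); rewrite addrA subrK. Qed.

Lemma norm_sum (I : Type) (r : seq I) (F : I -> 'cV[R]_d) :
  N (\sum_(i <- r) F i) <= \sum_(i <- r) N (F i).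
Proof.
elim: r => [|i r IH]; first by rewrite !big_nil norm0.
by rewrite !big_cons (le_trans (normD _ _)) // lerD2l.
Qed.

Lemma norm_upper : exists2 C, 0 < C & forall x, N x <= C * `|x|.
Proof.
(* The summand 1 keeps the constant positive even in dimension 0. *)
exists (1 + \sum_k N (delta_mx k 0)) => [|x].
  by rewrite ltr_pwDl // sumr_ge0 // => k _; exact: norm_ge0.
rewrite {1}(_ : x = \sum_k x k 0 *: delta_mx k 0); last first.
  by rewrite [LHS]matrix_sum_delta; apply: eq_bigr => k _; rewrite big_ord1.
rewrite (le_trans (norm_sum _ _)) // mulrDl mul1r mulr_suml.
rewrite -[leLHS]add0r lerD ?normr_ge0 // ler_sum // => k _.
by rewrite normZ mulrC ler_wpM2l ?norm_ge0 // mxnorm_entry.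
Qed.

Lemma is_norm_continuous : continuous N.
Proof.
have [C C0 NC] := norm_upper.
move=> x; apply/(@cvgrPdist_le R R^o _ (nbhs x)) => e e0.
near=> y.
have xy : C * `|x - y| <= e.
  rewrite mulrC -ler_pdivlMr //; near: y.
  by apply: (@near_dist_le R _ (x : 'cV[R]_d)); rewrite divr_gt0.
rewrite ler_norml; have := NC (x - y).
have := normD (x - y) y; have := normD (y - x) x.
by rewrite !subrK norm_distC => *; apply/andP; split; lra.
Unshelve. all: by end_near. Qed.

(* The minimum of N on the unit sphere of the sup norm is positive. *)
Lemma norm_lower : exists2 C, 0 < C & forall x, `|x| <= C * N x.
Proof.
(* The sphere is taken among row vectors, where [bounded_closed_compact] applies; transposition is
   an isometry. *)
pose S := [set u : 'rV[R]_d | `|u| = 1].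
have nrmS x : x != 0 -> S (`|x|^-1 *: x)^T.
  move=> x0; rewrite /S /= mxnorm_tr normrZ ger0_norm ?invr_ge0 //.
  by rewrite mulVf // normr_eq0.
have [[u Su]|S0] := pselect (S !=set0); last first.
  exists 1 => // x; have [->|x0] := eqVneq x 0; first by rewrite normr0 norm0 mulr0.
  by exfalso; apply: S0; eexists; exact: nrmS x0.
have cS : compact S.
  apply: bounded_closed_compact.
    by exists 1; split => // M M1 v /= ->; exact: ltW.
  rewrite (_ : S = Num.norm @^-1` [set 1]) //.
  apply: closed_comp; last exact: closed_eq.
  by move=> v _; exact: norm_continuous.
have ctr : continuous (fun u : 'rV[R]_d => N u^T).
  move=> v; apply: continuous_comp; last exact: is_norm_continuous.
  by apply/(@cvgrPdist_le R _ _ (nbhs v)) => e e0; near=> w;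
    rewrite -linearB mxnorm_tr; near: w; exact: (@near_dist_le R _ (v : 'rV[R]_d)).
have [c cS' cmin] := @compact_EVT_min _ R (fun u : 'rV[R]_d => N u^T) S
  (ex_intro _ u Su) cS (continuous_subspaceT ctr).
have Nc : 0 < N c^T.
  rewrite lt_neqAle norm_ge0 andbT eq_sym; apply/eqP; case: hN => N0 _ _ /N0 /eqP.
  rewrite trmx_eq0 => /eqP c0; move: cS'; rewrite inE /S /= c0 normr0 => /esym/eqP.
  by rewrite oner_eq0.
exists (N c^T)^-1 => [|x]; first by rewrite invr_gt0.
have [->|x0] := eqVneq x 0; first by rewrite normr0 norm0 mulr0.
have /cmin : (`|x|^-1 *: x)^T \in S by rewrite inE; exact: nrmS.
rewrite trmxK normZ ger0_norm ?invr_ge0 // mulrC ler_pdivlMr ?normr_gt0 //.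
by rewrite mulrC ler_pdivlMl // mulrC.
Unshelve. all: by end_near. Qed.

(** The supremum defining [op_norm] is meaningful once its set is bounded, which follows by
    expanding [M *m y] along the columns of [M]; rescaling [x] then gives the bound. *)
Lemma op_norm_bound M x : N (M *m x) <= op_norm N M * N x.
Proof.
have [C1 C10 NC] := norm_upper; have [C2 C20 CN] := norm_lower.
have [D MD] : exists D : R, forall y, N (M *m y) <= D * N y.
  exists (\sum_k N (col k M) * C2) => y.
  rewrite (_ : M *m y = \sum_k y k 0 *: col k M); last first.
    apply/matrixP => i j; rewrite !mxE summxE; apply: eq_bigr => k _.
    by rewrite !mxE ord1 mulrC.
  rewrite (le_trans (norm_sum _ _)) // mulr_suml ler_sum // => k _.
  rewrite normZ mulrC -mulrA ler_wpM2l ?norm_ge0 //.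
  exact: le_trans (mxnorm_entry _ _ _) (CN _).
have hs : has_sup [set N (M *m y) | y in [set y | N y <= 1]].
  split; first by exists (N (M *m 0)), 0 => //=; rewrite norm0.
  exists `|D| => _ [y /= y1 <-]; rewrite (le_trans (MD y)) //.
  rewrite (le_trans (ler_norm _)) // normrM ler_piMr // ger0_norm //.
  exact: norm_ge0.
have [->|x0] := eqVneq x 0; first by rewrite mulmx0 norm0 mulr0.
have Nx : 0 < N x.
  by rewrite lt_neqAle norm_ge0 andbT eq_sym; apply: contra x0 => /eqP;
    case: hN => N0 _ _ /N0 ->.
rewrite -ler_pdivrMr // mulrC.
rewrite -[X in X * _](ger0_norm (_ : 0 <= (N x)^-1)) ?invr_ge0 ?norm_ge0 //.
rewrite -normZ scalemxAr; apply: (ub_le_sup hs.2).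
exists ((N x)^-1 *: x) => //=.
by rewrite normZ ger0_norm ?invr_ge0 ?norm_ge0 // mulVf // gt_eqF.
Qed.

Lemma dotvB (u x y : 'cV[R]_d) : dotv u (x - y) = dotv u x - dotv u y.
Proof.
by rewrite /dotv -sumrB; apply: eq_bigr => k _; rewrite !mxE mulrBr.
Qed.

Lemma dotv_bound (u : 'cV[R]_d) :
  exists2 C, 0 <= C & forall x, `|dotv u x| <= C * N x.
Proof.
have [C C0 CN] := norm_lower.
exists (\sum_k `|u k 0| * C) => [|x].
  by rewrite sumr_ge0 // => k _; rewrite mulr_ge0 // ltW.
rewrite (le_trans (ler_norm_sum _ _ _)) // mulr_suml ler_sum // => k _.
rewrite normrM -mulrA ler_wpM2l //.
exact: le_trans (mxnorm_entry _ _ _) (CN _).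
Qed.

End Norm.

(** * Null sets *)

Section NullSets.
Context {R : realType} {l : nat}.
Implicit Types (E F : set ('I_l -> R)) (a b : 'I_l -> R).

Definition box a b : set ('I_l -> R) := [set mu | forall j, a j <= mu j <= b j].

Definition box_vol a b : R := \prod_(j < l) (b j - a j).

Lemma box_vol_ge0 a b : (forall j, a j <= b j) -> 0 <= box_vol a b.
Proof. by move=> ab; rewrite prodr_ge0 // => j _; rewrite subr_ge0. Qed.

Lemma lebesgue_null_sub E F : E `<=` F -> lebesgue_null F -> lebesgue_null E.
Proof.
move=> EF nF e /nF [a [b [ab [Fab s]]]]; exists a, b; split => //; split => //.
exact: subset_trans Fab.
Qed.

(** A finite cover becomes a sequence by padding with degenerate boxes, whose volume is 0 because
    the product over coordinates is nonempty. *)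
Lemma lebesgue_null_fin E : (0 < l)%N ->
  (forall e : R, 0 < e -> exists (I : finType) (a b : I -> 'I_l -> R),
    [/\ forall i j, a i j <= b i j,
        E `<=` \bigcup_i box (a i) (b i) &
        \sum_i box_vol (a i) (b i) <= e]) ->
  lebesgue_null E.
Proof.
move=> l0 cov e /cov [I [a [b [ab Eab s]]]].
pose L := [seq Some i | i <- enum I].
pose A (f : I -> 'I_l -> R) n := if nth None L n is Some i then f i else fun=> 0.
exists (A a), (A b); split => [n j|]; first by rewrite /A; case: nth.
split=> [mu /Eab [i _ mui]|K].
  exists (index i (enum I)) => // j.
  have iI : i \in enum I by rewrite mem_enum.
  by rewrite /A (nth_map i) ?index_mem // nth_index.
apply: le_trans s.
pose g (o : option I) := if o is Some i then box_vol (a i) (b i) else 0.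
have g0 o : 0 <= g o by case: o => //= i; apply: box_vol_ge0.
have gN : g None = 0 by [].
have -> : \sum_i box_vol (a i) (b i) = \sum_(o <- L) g o.
  by rewrite big_map big_enum.
rewrite (eq_bigr (fun n : 'I_K => g (nth None L n))); last first.
  move=> n _; rewrite /A; case: nth => // /=.
  by rewrite (bigD1 (Ordinal l0)) //= subrr mul0r.
elim: {A} L K => [|o L IH] K; first by rewrite big_nil big1 // => n _; rewrite nth_nil.
case: K => [|K]; first by rewrite big_ord0 sumr_ge0.
by rewrite big_ord_recl big_cons lerD2l; exact: IH.
Qed.

(** Finitely many pairs lie in a square; this bounds sums along an enumeration of pairs by iterated
    sums. *)
Lemma sum_pairs_le (G : nat * nat -> R) (s : seq (nat * nat)) :
  (forall p, 0 <= G p) -> uniq s ->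
  exists M, \sum_(p <- s) G p <= \sum_(i < M) \sum_(n < M) G (i : nat, n : nat).
Proof.
move=> G0 us.
pose M := (\max_(p <- s) maxn p.1 p.2).+1; exists M.
have sM p : p \in s -> (p.1 < M)%N && (p.2 < M)%N.
  move=> ps; have : (maxn p.1 p.2 <= \max_(p <- s) maxn p.1 p.2)%N.
    exact: leq_bigmax_seq.
  by rewrite geq_max /M !ltnS.
pose L := [seq (i, n) | i <- iota 0 M, n <- iota 0 M].
have uL : uniq L by rewrite allpairs_uniq ?iota_uniq // => -[? ?] [].
have -> : \sum_(i < M) \sum_(n < M) G (i : nat, n : nat) = \sum_(p <- L) G p.
  rewrite big_allpairs -[M in iota 0 M]subn0 -/(index_iota 0 M) big_mkord.
  by apply: eq_bigr => i _; rewrite -/(index_iota 0 M) big_mkord.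
rewrite [leRHS](bigID (mem s)) /= -[leLHS]addr0 lerD ?sumr_ge0 //.
suff ps : perm_eq s [seq p <- L | mem s p] by rewrite (perm_big _ ps) big_filter.
apply: uniq_perm; rewrite ?filter_uniq // => p; rewrite mem_filter /=.
case ps: (p \in s) => //=; case/andP: (sM p ps) => p1 p2.
by apply/esym/allpairsP; exists p; rewrite !mem_iota add0n p1 p2; case: p {ps p1 p2}.
Qed.

(** The n-th set gets a cover of volume at most e / 2^(n+1), and the covers are merged along an
    enumeration of pairs; integers coding no pair get degenerate boxes. *)
Lemma lebesgue_null_bigcup (F : nat -> set ('I_l -> R)) : (0 < l)%N ->
  (forall n, lebesgue_null (F n)) -> lebesgue_null (\bigcup_n F n).
Proof.
move=> l0 nF e e0.
pose e_ n : R := e / 2 ^+ n.+1.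
have e_0 n : 0 < e_ n by rewrite divr_gt0 // exprn_gt0.
have [a /choice [b ab]] := choice (fun n => nF n (e_ n) (e_0 n)).
pose A (f : nat -> nat -> 'I_l -> R) k :=
  if @pickle_inv (nat * nat)%type k is Some p then f p.1 p.2 else fun=> 0.
exists (A a), (A b); split => [k j|]; first by rewrite /A; case: pickle_inv => // p; case: (ab p.1).
split=> [mu [n _ Fmu]|K].
  have [_ [/(_ mu Fmu) [m _ mum] _]] := ab n.
  by exists (pickle (n, m)) => // j; rewrite /A pickleK_inv.
pose G p := box_vol (a p.1 p.2) (b p.1 p.2).
have G0 p : 0 <= G p by apply: box_vol_ge0; case: (ab p.1).
pose s := pmap (@pickle_inv (nat * nat)%type) (iota 0 K).
have us : uniq s.
  by apply: (pmap_uniq (g := pickle)); [exact: pickle_invK | exact: iota_uniq].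
have [M sM] := sum_pairs_le G0 us.
rewrite (_ : \sum_(n < K) _ = \sum_(p <- s) G p); last first.
  rewrite /s big_pmap -[K in iota 0 K]subn0 -/(index_iota 0 K) big_mkord.
  apply: eq_bigr => k _; rewrite /A; case: pickle_inv => //=.
  by rewrite (bigD1 (Ordinal l0)) //= subrr mul0r.
apply: (le_trans sM).
apply: (@le_trans _ _ (\sum_(i < M) e_ i)).
  by apply: ler_sum => i _; have [_ [_ /(_ M)]] := ab i.
rewrite (_ : \sum_(i < M) e_ i = e * (1 - (2 ^+ M)^-1)).
  by rewrite ler_piMr ?(ltW e0) // gerBl invr_ge0 exprn_ge0.
elim: M {sM} => [|M IH]; first by rewrite big_ord0 expr0 invr1 subrr mulr0.
rewrite big_ord_recr /= IH /e_ exprS.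
have : 2 ^+ M != 0 :> R by rewrite expf_neq0.
by move=> ?; field.
Qed.

Lemma lebesgue_null0 : (0 < l)%N -> lebesgue_null (set0 : set ('I_l -> R)).
Proof.
move=> l0; apply: lebesgue_null_fin => // e e0.
exists void, (fun=> fun=> 0), (fun=> fun=> 0); split => //.
by rewrite big_pred0 ?ltW // => -[].
Qed.

Lemma lebesgue_null_bigcup_count (T : countType) (F : T -> set ('I_l -> R)) :
  (0 < l)%N -> (forall t, lebesgue_null (F t)) ->
  lebesgue_null (\bigcup_t F t).
Proof.
move=> l0 nF.
pose G k := if @unpickle T k is Some t then F t else set0.
apply: (@lebesgue_null_sub _ (\bigcup_k G k)).
  by move=> mu [t _ Ft]; exists (pickle t) => //; rewrite /G pickleK.
apply: lebesgue_null_bigcup => // k; rewrite /G; case: unpickle => //.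
exact: lebesgue_null0.
Qed.

Lemma unit_cell (m : nat) (y : R) : (0 < m)%N -> 0 <= y <= m%:R ->
  exists k : 'I_m, k%:R <= y <= k%:R + 1.
Proof.
move=> m0 /andP[y0 ym].
have := truncn_itv y0; set k := Num.truncn y => /andP[ky yk].
(* The right endpoint y = m is assigned to the last cell. *)
have [km|mk] := ltnP k m.
  by exists (Ordinal km) => /=; rewrite ky natr1 ltW.
have pm : (m.-1 < m)%N by rewrite prednK.
exists (Ordinal pm) => /=; rewrite natr1 prednK // ym andbT.
by rewrite (le_trans _ ky) // ler_nat (leq_trans _ mk) // leq_pred.
Qed.

(* Cut the coordinates other than [j0] into [m] pieces: the hyperplane is then
   covered by boxes of width O(1/m) in direction [j0]. *)
Lemma lebesgue_null_hyperplane (c : 'I_l -> R) (t : R) (j0 : 'I_l) :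
  c j0 != 0 -> lebesgue_null [set mu | \sum_j c j * mu j = t].
Proof.
move=> c0; have l0 : (0 < l)%N := leq_ltn_trans (leq0n _) (ltn_ord j0).
apply: (@lebesgue_null_sub _ (\bigcup_M
  [set mu | \sum_j c j * mu j = t /\ forall j, `|mu j| <= M.+1%:R])).
  move=> mu /= mut; exists (\sum_j Num.bound (mu j))%N => //; split => // j.
  rewrite (le_trans (ltW (archi_boundP (normr_ge0 _)))) // /Num.bound.
  rewrite ler_nat /= ltnW // ltnS (bigD1 j) //= /Num.bound normr_id.
  exact: leq_addr.
apply: lebesgue_null_bigcup => // M0; set M : R := M0.+1%:R.
have M_gt0 : 0 < M by rewrite ltr0n.
apply: lebesgue_null_fin => // e e0.
pose C := (\sum_j `|c j|) / `|c j0|.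
have C0 : 0 <= C by rewrite divr_ge0 // sumr_ge0.
pose P := \prod_(j | j != j0) (2 * M).
have P0 : 0 <= P by rewrite prodr_ge0 // => *; rewrite mulr_ge0 // ltW.
(* Makes the total volume 2 r P = 4 C M P / m at most [e]. *)
pose m := (Num.bound (4 * C * M * P / e)).+1.
pose h : R := 2 * M / m%:R.
pose r := C * h.
have m0 : 0 < m%:R :> R by rewrite ltr0n.
have h0 : 0 <= h by rewrite divr_ge0 ?mulr_ge0 // ltW.
have r0 : 0 <= r by rewrite mulr_ge0.
pose lo (g : {ffun 'I_l -> 'I_m}) j := - M + h * (g j)%:R.
pose s g := (t - \sum_(j | j != j0) c j * lo g j) / c j0.
(* Coordinate [j0] is not subdivided: only the functions with [g j0 = ord0] carry half-width [r],
   the others are degenerate and add no volume. *)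
pose w (k : 'I_m) := if k == ord0 then r else 0.
have w0 k : 0 <= w k by rewrite /w; case: ifP.
exists {ffun 'I_l -> 'I_m},
  (fun g j => if j == j0 then s g - w (g j) else lo g j),
  (fun g j => if j == j0 then s g + w (g j) else lo g j + h); split.
- move=> g j; case: ifP => _; last by rewrite lerDl.
  by have := w0 (g j); lra.
- move=> mu /= [mut muM].
  have cell j : exists k : 'I_m, - M + h * k%:R <= mu j <= - M + h * k%:R + h.
    have := muM j; rewrite ler_norml => /andP[muM1 muM2].
    have hN0 : h != 0 by rewrite gt_eqF // divr_gt0 ?mulr_gt0.
    have hp : 0 < h by rewrite lt0r hN0.
    have [||k /andP[k1 k2]] := @unit_cell m ((mu j + M) / h); first by [].
      rewrite divr_ge0 //= ?ler_pdivrMr //; last by lra.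
      by rewrite /h mulrC divfK ?gt_eqF //; lra.
    exists k; move: k1 k2; rewrite ler_pdivlMr // ler_pdivrMr // mulrDl mul1r.
    by rewrite (mulrC h) => *; apply/andP; split; lra.
  have [g0 g0P] := choice cell.
  pose g := [ffun j => if j == j0 then ord0 : 'I_m else g0 j].
  have gP j : j != j0 -> lo g j <= mu j <= lo g j + h.
    by move=> jj0; rewrite /lo ffunE (negbTE jj0); exact: g0P.
  exists g => // j; case: eqP => [->|/eqP]; last exact: gP.
  rewrite /w ffunE eqxx eqxx -ler_distl.
  (* The equation of the hyperplane is solved for [mu j0], so the errors in the other coordinates
     control the distance to [s g]. *)
  have -> : mu j0 - s g = (\sum_(j | j != j0) c j * (lo g j - mu j)) / c j0.
    apply: (mulIf c0); rewrite mulrBl !divfK // -mut (bigD1 j0) //=.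
    have -> : \sum_(j | j != j0) c j * (lo g j - mu j) =
        \sum_(j | j != j0) c j * lo g j - \sum_(j | j != j0) c j * mu j.
      by rewrite -sumrB; apply: eq_bigr => i _; rewrite mulrBr.
    by ring.
  rewrite normrM normfV /r /C mulrAC ler_wpM2r ?invr_ge0 //.
  rewrite (le_trans (ler_norm_sum _ _ _)) // [in leRHS](bigD1 j0) //= mulrDl.
  rewrite -[leLHS]add0r lerD ?mulr_ge0 // mulr_suml ler_sum // => i ii0.
  rewrite normrM ler_wpM2l // distrC ler_norml.
  by have := gP i ii0; lra.
- pose F j (k : 'I_m) := if j == j0 then 2 * w k else h.
  rewrite (eq_bigr (fun g : {ffun 'I_l -> 'I_m} => \prod_j F j (g j))); last first.
    by move=> g _; apply: eq_bigr => j _; rewrite /F; case: ifP => _; ring.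
  (* Volumes are products over coordinates, so the sum over all [g] factors. *)
  rewrite -bigA_distr_bigA (bigD1 j0) //=.
  have -> : \prod_(j | j != j0) \sum_k F j k = P.
    apply: eq_bigr => j jj0; rewrite /F (negbTE jj0) sumr_const card_ord.
    by rewrite -(mulr_natr h m) /h divfK // gt_eqF.
  rewrite /F eqxx (bigD1 ord0) //= big1 => [|k k0]; last first.
    by rewrite /w (negbTE k0) mulr0.
  rewrite addr0 /w eqxx /r /h.
  rewrite (_ : _ * P = (4 * C * M * P) / m%:R); last by field; rewrite gt_eqF.
  rewrite ler_pdivrMr // -ler_pdivrMl // mulrC.
  have /archi_boundP/ltW/le_trans -> // : 0 <= 4 * C * M * P / e.
    by apply: divr_ge0 (ltW e0); do ![apply: mulr_ge0 => //]; exact: ltW.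
  by rewrite ler_nat.
Qed.

End NullSets.

(** * Words and generic parameters *)

Section Words.
Context {R : realType} {d l : nat}.
Variables (Lam : alphabet l -> 'M[R]_d) (b : alphabet l -> 'cV[R]_d).
Variable v : 'I_l -> 'cV[R]_d.
Implicit Types (u w : seq (alphabet l)) (x y : 'cV[R]_d) (mu : 'I_l -> R).
Implicit Types (h : nat -> option 'I_l) (i : alphabet l).

Definition Phi w x := foldl (fun y i => phi Lam b i y) x w.

Definition Lin w : 'M[R]_d := foldl (fun M i => Lam i *m M) 1%:M w.

Lemma Phi_cat u w x : Phi (u ++ w) x = Phi w (Phi u x).
Proof. exact: foldl_cat. Qed.

Lemma Phi_rcons w i x : Phi (rcons w i) x = phi Lam b i (Phi w x).
Proof. exact: foldl_rcons. Qed.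

Lemma Phi_linear w x : Phi w x = Lin w *m x + Phi w 0.
Proof.
elim/last_ind: w => [|w i IH]; first by rewrite /Lin /= mul1mx addr0.
by rewrite !Phi_rcons /phi IH /Lin foldl_rcons mulmxDr mulmxA addrA.
Qed.

Lemma Phi_sub w x y : Phi w x - Phi w y = Lin w *m (x - y).
Proof.
by rewrite (Phi_linear w x) (Phi_linear w y) opprD addrACA subrr addr0 mulmxBr.
Qed.

(* The cell conditions are taken with non-strict inequalities on both sides, so
   that realizability is closed in [(mu, x)]. *)
Definition compat mu i x :=
  forall j, if i j then mu j <= dotv (v j) x else dotv (v j) x <= mu j.

Fixpoint real mu w x :=
  if w is i :: w' then compat mu i x /\ real mu w' (phi Lam b i x) else True.

Lemma real_cat mu u w x : real mu (u ++ w) x <-> real mu u x /\ real mu w (Phi u x).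
Proof.
elim: u x => [|i u IH] x /=; first by split=> [|[]].
by rewrite IH; split=> [[? []]|[[? ?] ?]].
Qed.

Lemma compat_label mu x : compat mu (label v mu x) x.
Proof. by move=> j; rewrite ffunE; case: ltP => // /ltW. Qed.

(** The gradient of [x |-> dotv (v j) (Phi w x)]; see [dotv_Phi]. *)
Definition row_of w (j : 'I_l) : 'rV[R]_d := (v j)^T *m Lin w.

Lemma dotvE (y x : 'cV[R]_d) : dotv y x = (y^T *m x) 0 0.
Proof. by rewrite mxE; apply: eq_bigr => k _; rewrite mxE. Qed.

Lemma dotv_Phi w j x :
  dotv (v j) (Phi w x) = (row_of w j *m x) 0 0 + dotv (v j) (Phi w 0).
Proof. by rewrite Phi_linear dotvE mulmxDr mxE mulmxA -dotvE. Qed.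

Section Contraction.
Variables (N : 'cV[R]_d -> R) (lam : R).
Hypotheses (hN : is_norm N) (lam0 : 0 < lam).
Hypothesis hlam : forall i x, N (Lam i *m x) <= lam * N x.

Lemma norm_Lin w x : N (Lin w *m x) <= lam ^+ size w * N x.
Proof.
elim/last_ind: w => [|w i IH]; first by rewrite mul1mx expr0 mul1r.
rewrite /Lin foldl_rcons -/(Lin w) -mulmxA (le_trans (hlam _ _)) //.
by rewrite size_rcons exprS -mulrA ler_wpM2l // ltW.
Qed.

Lemma norm_Phi w x y : N (Phi w x - Phi w y) <= lam ^+ size w * N (x - y).
Proof. by rewrite Phi_sub norm_Lin. Qed.

(** Each entry is [dotv (v j)] at the image of a basis vector under the contraction [Lin w]. *)
Lemma row_of_bound :
  exists2 C, 0 <= C & forall w j k, `|row_of w j 0 k| <= C * lam ^+ size w.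
Proof.
have /choice [C CP] : forall j, exists C, 0 <= C /\ forall x, `|dotv (v j) x| <= C * N x.
  by move=> j; have [C C0 CP] := dotv_bound hN (v j); exists C.
pose D := \sum_k N (delta_mx k 0).
have D0 : 0 <= D by apply: sumr_ge0 => k _; exact: norm_ge0.
have E0 : 0 <= \sum_j C j by apply: sumr_ge0 => j _; case: (CP j).
exists ((\sum_j C j) * D); first exact: mulr_ge0.
move=> w j k; have -> : row_of w j 0 k = dotv (v j) (Lin w *m delta_mx k 0).
  by rewrite dotvE -colE !mxE; apply: eq_bigr => c _; rewrite !mxE.
have [C0 Cx] := CP j; rewrite (le_trans (Cx _)) // -mulrA.
apply: ler_pM => //; first exact: norm_ge0.
  by rewrite (bigD1 j) //= lerDl sumr_ge0 // => i _; case: (CP i).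
rewrite (le_trans (norm_Lin _ _)) // mulrC ler_wpM2r ?exprn_ge0 ?(ltW lam0) //.
by rewrite /D (bigD1 k) //= lerDl sumr_ge0 // => i _; exact: norm_ge0.
Qed.

End Contraction.

(** [h k = Some j] prescribes a hit of [H_j] at time [k]; [None] gives a zero row. The prescribed
    hits read A x + const = B mu, with A = [Amx w h q] and B = [Bmx h q]. *)
Definition Amx w h q : 'M[R]_(q, d) :=
  \matrix_(k < q, c < d) (if h k is Some j then row_of (take k w) j 0 c else 0).

Definition Bmx h q : 'M[R]_(q, l) :=
  \matrix_(k < q, c < l) (if h k is Some j then (c == j)%:R else 0).

Definition hits_ok mu w h q x := forall k j, (k < q)%N -> h k = Some j ->
  dotv (v j) (Phi (take k w) x) = mu j.

(* Whenever some orbit meets the hyperplanes [h k] at times [k < q] along [w],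
   the equations satisfied by its starting point have linearly dependent left
   hand sides only if the same dependency holds between the parameters [mu]. *)
Definition generic mu := forall w h q, (exists x, hits_ok mu w h q x) ->
  ((Bmx h q)^T <= (Amx w h q)^T)%MS.

Lemma AB_ext w w' h h' q :
  (forall k, (k < q)%N -> take k w = take k w') ->
  (forall k, (k < q)%N -> h k = h' k) ->
  Amx w h q = Amx w' h' q /\ Bmx h q = Bmx h' q.
Proof.
move=> ww hh; split; apply/matrixP => k c; rewrite !mxE hh //.
by case: (h' k) => // j; rewrite ww.
Qed.

(** A combination of rows that kills A but not B turns A x + const = B mu into a nontrivial linear
    equation for [mu] alone. *)
Lemma lebesgue_null_hits w h q : (0 < l)%N ->
  ~~ ((Bmx h q)^T <= (Amx w h q)^T)%MS ->
  lebesgue_null [set mu | exists x, hits_ok mu w h q x].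
Proof.
move=> l0; rewrite submxE => nsub.
(* The rows of [K] span the left kernel of A. *)
pose K := (cokermx (Amx w h q)^T)^T.
have KA : K *m Amx w h q = 0.
  by apply: trmx_inj; rewrite trmx_mul trmxK mulmx_coker trmx0.
have : K *m Bmx h q != 0 by rewrite -trmx_eq0 trmx_mul trmxK.
move=> /matrix0Pn [r [j0 rj0]].
pose cst := \col_k (if h k is Some j then dotv (v j) (Phi (take k w) 0) else 0) : 'cV[R]_q.
apply: lebesgue_null_sub (lebesgue_null_hyperplane ((K *m cst) r 0) rj0).
move=> mu [x hx] /=.
have BA : Bmx h q *m (\col_j mu j) = Amx w h q *m x + cst.
  apply/matrixP => k c; rewrite !ord1 {c} !mxE.
  case hk: (h k) => [j|]; last first.
    rewrite addr0 !big1 // => [c _|c _]; first by rewrite !mxE hk mul0r.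
    by rewrite !mxE hk mul0r.
  rewrite (bigD1 j) //= big1 => [|c cj]; last by rewrite !mxE hk (negbTE cj) mul0r.
  rewrite !mxE hk eqxx mul1r addr0 -(hx k) // dotv_Phi; congr (_ + _).
  by rewrite mxE; apply: eq_bigr => c _; rewrite [X in _ = X * _]mxE hk.
have : K *m (Bmx h q *m (\col_j mu j)) = K *m cst.
  by rewrite BA mulmxDr mulmxA KA mul0mx add0r.
move=> /(congr1 (fun M : 'cV[R]_q => M r 0)) <-.
by rewrite mulmxA [RHS]mxE; apply: eq_bigr => j _; rewrite [X in _ = _ * X]mxE.
Qed.

Lemma lebesgue_null_nongeneric : (0 < l)%N -> lebesgue_null [set mu | ~ generic mu].
Proof.
move=> l0.
pose F (s : seq (alphabet l) * seq (option 'I_l)) := [set mu : 'I_l -> R |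
  ~~ ((Bmx (nth None s.2) (size s.2))^T <= (Amx s.1 (nth None s.2) (size s.2))^T)%MS
  /\ exists x, hits_ok mu s.1 (nth None s.2) (size s.2) x].
apply: (@lebesgue_null_sub _ _ _ (\bigcup_s F s)).
  move=> mu; apply: contra_notP => nF w h q [x hx].
  (* Only the first [q] values of [h] matter; as finite sequences they leave countably many
     conditions. *)
  have hh k : (k < q)%N -> h k = nth None (mkseq h q) k by move=> kq; rewrite nth_mkseq.
  have [-> ->] := AB_ext (fun k _ => erefl (take k w)) hh.
  apply: contra_notT nF => nsub; exists (w, mkseq h q) => //.
  rewrite /F /= size_mkseq; split => //; exists x => k j kq.
  by rewrite nth_mkseq //; exact: hx.
apply: lebesgue_null_bigcup_count => // s.
have [sub|nsub] := boolP
  ((Bmx (nth None s.2) (size s.2))^T <= (Amx s.1 (nth None s.2) (size s.2))^T)%MS.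
  apply: (@lebesgue_null_sub _ _ _ set0); first by move=> mu []; rewrite sub.
exact: lebesgue_null0.
by apply: lebesgue_null_sub (lebesgue_null_hits l0 nsub) => mu [].
Qed.

End Words.

(** * Density of hits *)

Section HitDensity.
Context {R : realType} {d l : nat}.
Variables (Lam : alphabet l -> 'M[R]_d) (b : alphabet l -> 'cV[R]_d).
Variable v : 'I_l -> 'cV[R]_d.
Variables (N : 'cV[R]_d -> R) (lam : R).
Hypotheses (hN : is_norm N) (lam0 : 0 < lam) (lam1 : lam < 1).
Hypothesis hlam : forall i x, N (Lam i *m x) <= lam * N x.
Variable mu : 'I_l -> R.
Hypothesis gmu : generic Lam b v mu.
Implicit Types (u w : seq (alphabet l)) (x y : 'cV[R]_d) (q n k : nat).
Implicit Types (h : nat -> option 'I_l) (i : alphabet l).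

Local Notation Phi := (Phi Lam b).
Local Notation Amx := (Amx Lam v).
Local Notation Bmx := (@Bmx R l).
Local Notation hits_ok := (hits_ok Lam b v mu).

(** A solution T of A T = B when the hits occur: it sends the row of a hit of [H_j] to the unit
    vector e_j. *)
Let Tmx w h q : 'M[R]_(d, l) := ((Bmx h q)^T *m pinvmx (Amx w h q)^T)^T.

Lemma TmxP w h q x : hits_ok w h q x -> Bmx h q = Amx w h q *m Tmx w h q.
Proof.
move=> hx; apply: trmx_inj; rewrite trmx_mul trmxK mulmxKpV //.
by apply: gmu; exists x.
Qed.

(** For fixed [q] only finitely many matrices occur, since they depend on finitely many letters and
    values of [h]. *)
Lemma Tmx_bound q : exists2 C, 0 <= C &
  forall w h, (q <= size w)%N -> `|Tmx w h q| <= C.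
Proof.
pose T (p : q.-tuple (alphabet l) * q.-tuple (option 'I_l)) :=
  Tmx p.1 (nth None p.2) q.
exists (\sum_p `|T p|) => [|w h qw]; first exact: sumr_ge0.
have sw : size (take q w) == q by rewrite size_takel.
have sh : size (mkseq h q) == q by rewrite size_mkseq.
suff -> : Tmx w h q = T (Tuple sw, Tuple sh).
  by rewrite (bigD1 (Tuple sw, Tuple sh)) //= lerDl sumr_ge0.
rewrite /T /Tmx; have [|k kq|-> ->] // :=
  @AB_ext _ _ _ Lam v w (take q w) h (nth None (mkseq h q)) q.
- by move=> k kq; rewrite take_takel // ltnW.
- by rewrite nth_mkseq.
Qed.

Lemma Amx_mono w h q n : (q <= n)%N -> (Amx w h q <= Amx w h n)%MS.
Proof.
move=> qn; apply/row_subP => k.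
rewrite (_ : row k _ = row (widen_ord qn k) (Amx w h n)) ?row_sub //.
by apply/rowP => c; rewrite !mxE.
Qed.

(* A late row is too short to be a combination of the first [q] rows, because
   the linear map [Tmx] sends it to a unit vector. *)
Lemma rank_jump q : exists2 n, (q <= n)%N & forall w h x k j,
  (n <= k <= size w)%N -> h k = Some j -> hits_ok w h k.+1 x ->
  (\rank (Amx w h q) < \rank (Amx w h k.+1))%N.
Proof.
have [C1 C10 rowC] := row_of_bound v hN lam0 hlam.
have [C2 C20 TC] := Tmx_bound q.
(* Past [n0], a row of A times [Tmx w h q] has entries below 1 in absolute value. *)
have [n0 n0P] : exists n0, forall k, (n0 <= k)%N -> d%:R * C1 * C2 * lam ^+ k < 1.
  have : (fun k => d%:R * C1 * C2 * lam ^+ k) @ \oo --> d%:R * C1 * C2 * 0.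
    apply: cvgM; first exact: cvg_cst.
    by apply: cvg_expr; rewrite ger0_norm // ltW.
  rewrite mulr0 => /cvgr_lt /(_ 1 ltr01) [n0 _ n0P].
  by exists n0 => k; exact: n0P.
exists (maxn q n0) => [|w h x k j]; first exact: leq_maxl.
rewrite geq_max -andbA => /and3P[qk n0k kw] hk hx.
have qk1 : (q <= k.+1)%N by rewrite ltnW.
rewrite ltn_neqAle mxrankS ?Amx_mono // andbT.
rewrite (mxrank_leqif_sup (Amx_mono w h qk1)).
apply/negP => /row_subP /(_ ord_max) /submxP [m rowE].
have hq : hits_ok w h q x.
  by move=> k' j' k'q; apply: hx; exact: leq_trans k'q qk1.
have BT := TmxP hx; have BTq := TmxP hq; set T' := Tmx w h k.+1 in BT.
(* [T'] also solves the first [q] equations, so on the span of those rows it agrees with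
   [Tmx w h q], whose bound does not depend on [k]. *)
have BTq' : Bmx h q = Amx w h q *m T'.
  apply/row_matrixP => k'; have := congr1 (row (widen_ord qk1 k')) BT.
  rewrite !row_mul (_ : row _ (Bmx h k.+1) = row k' (Bmx h q)).
    move=> ->; congr (_ *m _).
    by apply/rowP => c; rewrite !mxE.
  by apply/rowP => c; rewrite !mxE.
have rowB : row ord_max (Bmx h k.+1) = row ord_max (Amx w h k.+1) *m Tmx w h q.
  by rewrite BT row_mul rowE -mulmxA -BTq' -mulmxA -BTq.
have := congr1 (fun M : 'rV[R]_l => M 0 j) rowB.
rewrite !mxE /= hk eqxx => /esym E1.
(* Entry [j] of the last row is 1 in B, yet below 1 by the choice of [n0]. *)
have /eqP : (1 : R) = `|1| by rewrite normr1.
rewrite gt_eqF // -[X in `|X|]E1 (le_lt_trans (ler_norm_sum _ _ _)) //.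
apply: le_lt_trans (n0P _ n0k).
rewrite -[X in X%:R * _ * _ * _]card_ord -!mulrA mulr_natl -sumr_const.
apply: ler_sum => c _; rewrite normrM 2![X in `|X| * _]mxE /= hk.
rewrite (mulrC C2) mulrA ler_pM //.
  by have := rowC (take k w) j c; rewrite size_takel.
by rewrite (le_trans (mxnorm_entry _ _ _)) // TC // (leq_trans qk).
Qed.

(** * Counting hits along a word *)

Definition onH x := [exists j, dotv (v j) x == mu j].

Fixpoint nhits w x : nat :=
  if w is i :: w' then (onH x + nhits w' (phi Lam b i x))%N else 0%N.

Lemma nhits_cat u w x : nhits (u ++ w) x = (nhits u x + nhits w (Phi u x))%N.
Proof. by elim: u x => [|i u IH] x //=; rewrite IH addnA. Qed.

Lemma nhits_size w x : (nhits w x <= size w)%N.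
Proof. by elim: w x => [|i w IH] x //=; rewrite -add1n leq_add // leq_b1. Qed.

Lemma nhits_eq0 w x :
  (forall k, (k < size w)%N -> ~~ onH (Phi (take k w) x)) -> nhits w x = 0%N.
Proof.
elim: w x => [|i w IH] x //= nh; rewrite (negbTE (nh 0%N _)) // IH // => k kw.
exact: (nh k.+1).
Qed.

(** Several hyperplanes may be met at once; one is recorded per time. *)
Let pickH w x k := [pick j | dotv (v j) (Phi (take k w) x) == mu j].

Lemma pickH_ok w x q : hits_ok w (pickH w x) q x.
Proof. by move=> k j _; rewrite /pickH; case: pickP => // j' /eqP + [<-]. Qed.

(** By induction on [r], either a prefix with few hits exists or the hits have rank at least [r].
    The rank is at most [d], so stage [d.+1] leaves only the first case. *)
Lemma good_prefix K : (0 < K)%N -> exists2 Q, (0 < Q)%N &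
  forall w x, (Q <= size w)%N ->
    exists2 n, (0 < n <= Q)%N & (nhits (take n w) x * K <= n)%N.
Proof.
move=> K0.
suff stage r : exists2 Q, (0 < Q)%N & forall w x, (Q <= size w)%N ->
    (exists2 n, (0 < n <= Q)%N & (nhits (take n w) x * K <= n)%N) \/
    (r <= \rank (Amx w (pickH w x) Q))%N.
  have [Q Q0 QP] := stage d.+1; exists Q => // w x /(QP w x) [//|].
  by rewrite leqNgt ltnS rank_leq_col.
elim: r => [|r [Q Q0 QP]]; first by exists 1%N => // w x _; right.
have [n Qn jump] := rank_jump Q.
have n0 : (0 < n)%N := leq_trans Q0 Qn.
have nKn : (n <= n * K)%N by rewrite leq_pmulr.
(* Without a hit from time [n] up to [n * K], the at most [n] early hits have density at most 1/K; a
   hit there raises the rank. *)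
exists (n * K)%N => [|w x nKw]; first by rewrite muln_gt0 n0.
have Qw : (Q <= size w)%N by rewrite (leq_trans Qn) // (leq_trans nKn).
have [[m /andP[m0 mQ] mP]|rk] := QP w x Qw.
  by left; exists m => //; rewrite m0 (leq_trans mQ) // (leq_trans Qn).
have [/existsP [k /andP[nk]]|/existsPn nohit] := boolP
    [exists k : 'I_(n * K), (n <= k)%N && onH (Phi (take k w) x)].
  move=> /existsP [j jH]; right.
  case hk: (pickH w x k) => [j'|]; last first.
    by move: hk; rewrite /pickH; case: pickP => // /(_ j); rewrite jH.
  apply: (leq_trans _ (mxrankS (Amx_mono _ _ (ltn_ord k)))).
  apply: leq_ltn_trans rk (jump _ _ x _ _ _ hk (@pickH_ok _ _ _)).
  by rewrite nk /= (leq_trans _ nKw) // ltnW.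
left; exists (n * K)%N; first by rewrite muln_gt0 n0 K0 leqnn.
rewrite -(cat_take_drop n (take _ w)) nhits_cat [X in (_ + X)%N]nhits_eq0.
  rewrite addn0 leq_mul2r take_takel // (leq_trans (nhits_size _ _)) ?orbT //.
  by rewrite size_take_min geq_minl.
move=> k; rewrite size_drop size_takel // => kn.
have nkn : (n + k < n * K)%N by rewrite -ltn_subRL.
have := nohit (Ordinal nkn); rewrite /= leq_addr /=.
by rewrite -Phi_cat -takeD take_takel // ltnW.
Qed.

(** Prefixes with few hits are split off repeatedly; the final piece, shorter than [Q], adds at most
    [Q] hits. *)
Lemma nhits_density K : (0 < K)%N ->
  exists2 Q, (0 < Q)%N & forall w x, (nhits w x * K <= size w + Q * K)%N.
Proof.
move=> K0; have [Q Q0 QP] := good_prefix K0; exists Q => // w.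
have [m] := ubnP (size w); elim: m w => // m IH w; rewrite ltnS => wm x.
have [Qw|wQ] := leqP Q (size w); last first.
  rewrite (leq_trans _ (leq_addl _ _)) // leq_mul2r.
  by rewrite (leq_trans (nhits_size _ _)) ?orbT // ltnW.
have [n /andP[n0 nQ] nP] := QP w x Qw.
have nw : (n <= size w)%N := leq_trans nQ Qw.
rewrite -{1}(cat_take_drop n w) nhits_cat mulnDl.
have dn : (size (drop n w) < m)%N by rewrite size_drop; lia.
have := IH _ dn (Phi (take n w) x); rewrite size_drop => H.
by move: nP H; lia.
Qed.

End HitDensity.

(** * Counting realized words *)

Section WordCount.
Context {R : realType} {d l : nat}.
Variables (Lam : alphabet l -> 'M[R]_d) (b : alphabet l -> 'cV[R]_d).
Variable v : 'I_l -> 'cV[R]_d.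
Variables (N : 'cV[R]_d -> R) (lam : R).
Hypotheses (hN : is_norm N) (lam0 : 0 < lam) (lam1 : lam < 1).
Hypothesis hlam : forall i x, N (Lam i *m x) <= lam * N x.
Implicit Types (u w : seq (alphabet l)) (x y : 'cV[R]_d) (m n k p q : nat).
Implicit Types (i : alphabet l) (mu : 'I_l -> R) (D : set 'cV[R]_d).

Local Notation Phi := (Phi Lam b).
Local Notation real := (real Lam b v).

(** Records only an upper bound: the list may contain further words. *)
Definition few mu D n p := exists2 s : seq (seq (alphabet l)), (size s <= p)%N &
  forall w x, size w = n -> D x -> real mu w x -> w \in s.

(** The tail of a word realized from [D] is realized from the image of [D] under the head, so the
    counts multiply. *)
Lemma few_cat mu D n m p q : few mu D n p ->
  (forall u, size u = n -> (exists2 x, D x & real mu u x) ->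
    few mu (Phi u @` D) m q) ->
  few mu D (n + m) (p * q).
Proof.
move=> [s sp sP] few2.
have /choice [f fP] : forall u, exists s', (size s' <= q)%N /\
    (size u = n -> (exists2 x, D x & real mu u x) ->
    forall w x, size w = m -> (Phi u @` D) x -> real mu w x -> w \in s').
  move=> u; have [[un ru]|nu] := pselect (size u = n /\ exists2 x, D x & real mu u x).
    by have [s' s'q s'P] := few2 u un ru; exists s'.
  by exists [::]; split => // un ru; case: nu.
exists [seq u ++ w | u <- s, w <- f u].
  rewrite size_allpairs_dep (leq_trans _ (leq_mul sp (leqnn q))) //.
  elim: (s) => //= u s' IH; rewrite mulSn leq_add //; exact: (fP u).1.
move=> w x wnm Dx; rewrite -(cat_take_drop n w) real_cat => -[r1 r2].
have tn : size (take n w) = n by rewrite size_takel // wnm leq_addr.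
apply/allpairsPdep; exists (take n w), (drop n w); split => //.
  exact: sP tn Dx r1.
apply: (fP (take n w)).2 tn (ex_intro2 _ _ x Dx r1) _ _ _ _ r2; last by exists x.
by rewrite size_drop wnm addKn.
Qed.

Lemma few_all mu D n : few mu D n (#|{: alphabet l}| ^ n).
Proof.
exists [seq tval t | t : n.-tuple (alphabet l)].
  by rewrite size_map -cardT card_tuple.
move=> w x /eqP wn _ _; apply/mapP; exists (Tuple wn) => //.
by rewrite mem_enum.
Qed.

Lemma card_alphabet_gt0 : (0 < #|{: alphabet l}|)%N.
Proof. by apply/card_gt0P; exists [ffun=> true]. Qed.

Lemma few_point mu x m h :
  (forall w, size w = m -> real mu w x -> (nhits Lam b v mu w x <= h)%N) ->
  few mu [set x] m (#|{: alphabet l}| ^ h).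
Proof.
elim: m x h => [|m IH] x h hx.
  exists [:: [::]] => [|w y /size0nil -> _ _]; last by rewrite inE.
  by rewrite /= expn_gt0 card_alphabet_gt0.
have [xH|xnH] := boolP (onH v mu x); last first.
  have fewx := IH (phi Lam b (label v mu x) x) h.
  have [|s sh sP] := fewx.
    move=> w wm rw; have := hx (label v mu x :: w); rewrite /= wm (negbTE xnH).
    by apply => //; split=> //; exact: compat_label.
  exists [seq label v mu x :: w | w <- s]; first by rewrite size_map.
  case=> // i w y [wm] -> /= [ci rw].
  have iE : i = label v mu x.
    apply/ffunP => j; rewrite ffunE.
    have := ci j; move/existsPn : xnH => /(_ j).
    by case: (i j); case: ltgtP.
  by rewrite iE in rw *; apply: map_f; exact: sP rw.
(* With no hit allowed, no nonempty word is realized from a point on a hyperplane, and the empty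
   list serves. *)
case: h hx => [|h] hx.
  exists [::] => // w y wm -> rw; have := hx w wm rw.
  by case: w wm rw => //= i w _ _; rewrite xH.
have : few mu [set x] 1 #|{: alphabet l}|.
  by have := few_all mu [set x] 1; rewrite expn1.
rewrite expnS -(add1n m) => /few_cat; apply => -[|i [|]] // _ [_ -> [ci _]].
have [|s sh sP] := IH (phi Lam b i x) h.
  move=> w wm rw; have := hx (i :: w); rewrite /= wm xH add1n ltnS.
  by apply.
exists s => // w y wm [z -> <-]; exact: sP.
Qed.

Lemma near_norm x (e : R) : 0 < e -> \forall y \near x, N (y - x) < e.
Proof.
move=> e0; have [C C0 NC] := norm_upper hN.
near=> y; rewrite (norm_distC hN) (le_lt_trans (NC _)) //.
have : `|x - y| <= e / (2 * C).
  by near: y; apply: (@near_dist_le R _ x); rewrite divr_gt0 // mulr_gt0.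
rewrite ler_pdivlMr ?mulr_gt0 // => H; rewrite mulrC.
by move: H; rewrite mulrCA => H; lra.
Unshelve. all: by end_near. Qed.

(** A violated inequality has a positive gap and stays violated nearby; contraction keeps the later
    points of the orbits close. *)
Lemma real_usc mu w x : \forall e \near (0 : R)^'+, forall mu' y,
  (forall j, `|mu' j - mu j| < e) -> N (y - x) < e -> real mu' w y -> real mu w x.
Proof.
elim: w x => [|i w IH] x; first exact: nearW.
have [ci|] := pselect (compat v mu i x).
  apply: filterS (IH (phi Lam b i x)) => e He mu' y mue ye /= [_ rw].
  split => //; apply: He rw => //.
  have := norm_Phi b lam0 hlam [:: i] y x; rewrite /= expr1 => /le_lt_trans -> //.
  by rewrite (le_lt_trans _ ye) // ler_piMl ?norm_ge0 // ltW.
move=> /existsNP [j nj]; have [C C0 CP] := dotv_bound hN (v j).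
pose g := `|mu j - dotv (v j) x|.
have g0 : 0 < g.
  rewrite normr_gt0 subr_eq0; apply/eqP => E; apply: nj.
  by rewrite E; case: (i j).
have C1 : 0 < 1 + C by lra.
have : \forall e \near (0 : R)^'+, e < g / (1 + C).
  by apply: nbhs_right_lt; rewrite divr_gt0.
apply: filterS => e eg mu' y /(_ j) mue ye /= [/(_ j) cj _]; exfalso; apply: nj.
have := CP (y - x); rewrite dotvB.
have : C * N (y - x) <= C * e by rewrite ler_wpM2l // ltW.
move: eg; rewrite ltr_pdivlMr // mulrDr mulr1 (mulrC e C) /g.
move: mue cj; case: (i j) => mue cj eg Ce; rewrite ler_norml => /andP[h1 h2];
  move: mue; rewrite ltr_norml => /andP[h3 h4]; rewrite leNgt; apply/negP => h5;
  move: eg; [rewrite gtr0_norm | rewrite ltr0_norm]; lra.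
Qed.

Lemma real_usc_words mu n x : \forall e \near (0 : R)^'+, forall w mu' y,
  size w = n -> (forall j, `|mu' j - mu j| < e) -> N (y - x) < e ->
  real mu' w y -> real mu w x.
Proof.
have : \forall e \near (0 : R)^'+, forall (t : n.-tuple (alphabet l)) mu' y,
    (forall j, `|mu' j - mu j| < e) -> N (y - x) < e -> real mu' t y -> real mu t x.
  by apply: filter_forall => t; exact: real_usc.
by apply: filterS => e He w mu' y /eqP wn; exact: (He (Tuple wn)).
Qed.

(** The form in which [compact_near_coveringP] is used; the two halves add up in the triangle
    inequality. *)
Lemma near_prod x (e : R) : 0 < e ->
  \forall y \near x & i \near (0 : R)^'+, N (y - x) < e / 2 /\ i < e / 2.
Proof.
move=> e0; exists ([set y | N (y - x) < e / 2], [set i | i < e / 2]) => //.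
by split; [apply: near_norm | apply: nbhs_right_lt]; rewrite divr_gt0.
Qed.

(** * Uniform bounds over the compact set [X] *)

Section Space.
Variable X : set 'cV[R]_d.
Hypothesis cX : compact X.
Hypothesis hX : forall i x, X x -> X (phi Lam b i x).

Lemma Phi_X w x : X x -> X (Phi w x).
Proof. by elim: w x => //= i w IH x Xx; apply: IH; exact: hX. Qed.

(** Compactness makes [real_usc] uniform over [X], so a bound on the words at [mu] holds for nearby
    parameters too. *)
Lemma near_params mu n : \forall e \near (0 : R)^'+, forall mu' w x,
  (forall j, `|mu' j - mu j| < e) -> size w = n -> X x -> real mu' w x ->
  exists2 y, X y & real mu w y.
Proof.
suff : \forall e \near (0 : R)^'+, X `<=` [set x | forall mu' w,
    (forall j, `|mu' j - mu j| < e) -> size w = n -> real mu' w x ->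
    exists2 y, X y & real mu w y].
  by apply: filterS => e He mu' w x mue wn Xx; exact: He.
move/compact_near_coveringP : cX; apply => x Xx.
have [e [He e0]] := filter_ex (filterI (real_usc_words mu n x) (nbhs_right_gt 0)).
apply: filterS (near_prod x e0) => -[y i] /= [ye ie] mu' w mue wn rw.
exists x => //; apply: He rw => //; last by rewrite (lt_trans ye) // gtr_pMr //; lra.
by move=> j; rewrite (lt_trans (mue j)) // (lt_trans ie) // gtr_pMr //; lra.
Qed.

(** A Lebesgue number argument: the list found at one point serves a ball around it, with a radius
    uniform over [X]. *)
Lemma small_diam_few mu m p : (forall x, X x -> few mu [set x] m p) ->
  exists2 r : R, 0 < r & forall D, D `<=` X ->
    (forall x y, D x -> D y -> N (x - y) < r) -> few mu D m p.
Proof.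
move=> fewx.
pose Q (r : R) x := exists2 s : seq (seq (alphabet l)), (size s <= p)%N &
  forall w y, size w = m -> N (y - x) < r -> real mu w y -> w \in s.
have : \forall r \near (0 : R)^'+, X `<=` Q r.
  move/compact_near_coveringP : cX; apply => x Xx.
  have [e [He e0]] := filter_ex (filterI (real_usc_words mu m x) (nbhs_right_gt 0)).
  have [s sp sP] := fewx x Xx.
  apply: filterS (near_prod x e0) => -[y i] /= [ye ie]; exists s => // w z wm zy rw.
  apply: (sP w x) => //; apply: He rw => // [j|]; first by rewrite subrr normr0.
  by have := norm_dist_trans hN y z x; move: (lt_trans zy ie); lra.
move=> /(filterI (nbhs_right_gt 0))/filter_ex [r [r0 Qr]]; exists r => // D DX Dr.
have [[x Dx]|D0] := pselect (D !=set0); last first.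
  by exists [::] => // w x _ Dx; exfalso; apply: D0; exists x.
have [s sp sP] := Qr x (DX _ Dx); exists s => // w y wm Dy; apply: sP => //.
exact: Dr.
Qed.

(** Images under words are no wider than [D], so the bound for small sets applies to every
    successive block. *)
Lemma few_iter mu m p (r : R) : (forall D, D `<=` X ->
    (forall x y, D x -> D y -> N (x - y) < r) -> few mu D m p) ->
  forall t D, D `<=` X -> (forall x y, D x -> D y -> N (x - y) < r) ->
    few mu D (t * m) (p ^ t).
Proof.
move=> fewD; elim=> [|t IH] D DX Dr; first exact: (few_all mu D 0).
rewrite mulSn expnS; apply: few_cat (fewD D DX Dr) _ => u _ _.
apply: IH => [_ [x Dx <-]|_ _ [x Dx <-] [y Dy <-]]; first exact/Phi_X/DX.
rewrite (le_lt_trans (norm_Phi b lam0 hlam _ _ _)) //.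
rewrite (le_lt_trans _ (Dr x y Dx Dy)) // ler_piMl ?norm_ge0 //.
by rewrite exprn_ile1 // ltW.
Qed.

Lemma compact_diam : exists2 r : R, 0 < r & forall x y, X x -> X y -> N (x - y) < r.
Proof.
have [C C0 NC] := norm_upper hN.
have [M [_ MX]] := compact_bounded cX.
have XM x : X x -> `|x| <= `|M| + 1.
  by apply: MX; rewrite (le_lt_trans (ler_norm _)) // ltrDl.
exists (C * (2 * (`|M| + 1)) + 1) => [|x y Xx Xy].
  by rewrite ltr_wpDl // mulr_ge0 ?(ltW C0) // mulr_ge0 // addr_ge0.
rewrite (le_lt_trans (NC _)) // (@le_lt_trans _ _ (C * (2 * (`|M| + 1)))) ?ltrDl //.
rewrite ler_wpM2l ?(ltW C0) // (le_trans (ler_normB _ _)) //.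
by have := XM x Xx; have := XM y Xy; lra.
Qed.

(** [K] makes q^2 lam^K at most 1/2. A block of length m = Q K has at most 2 Q hits, hence at most P
    = q^(2 Q) realized words from a point, and P lam^m is at most 1/2. *)
Lemma few_subexp mu : generic Lam b v mu ->
  exists2 n, (0 < n)%N & exists2 p, few mu X n p & p%:R * lam ^+ n < 1 :> R.
Proof.
move=> gmu; set q := #|{: alphabet l}|.
have [K K0 KP] : exists2 K, (0 < K)%N & (q ^ 2)%:R * lam ^+ K <= 1 / 2 :> R.
  have : (fun k => (q ^ 2)%:R * lam ^+ k) @ \oo --> (q ^ 2)%:R * (0 : R).
    apply: cvgM; first exact: cvg_cst.
    by apply: cvg_expr; rewrite ger0_norm // ltW.
  rewrite mulr0 => /cvgr_lt /(_ (1 / 2)) [|n0 _ n0P]; first by lra.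
  by exists n0.+1 => //; apply/ltW/n0P => /=.
have [Q Q0 QP] := nhits_density hN lam0 lam1 hlam gmu K0.
pose m := (Q * K)%N; pose P := (q ^ (2 * Q))%N.
have m0 : (0 < m)%N by rewrite muln_gt0 Q0.
have fewx x : X x -> few mu [set x] m P.
  move=> _; apply: few_point => w wm _; rewrite -(leq_pmul2r K0).
  by rewrite (leq_trans (QP w x)) // wm mul2n -addnn mulnDl.
have Pm : P%:R * lam ^+ m <= 1 / 2 :> R.
  rewrite /P /m expnM mulnC exprM natrX -exprMn.
  apply: (@le_trans _ _ ((1 / 2) ^+ Q)).
    by apply: lerXn2r => //; rewrite nnegrE ?mulr_ge0 ?exprn_ge0 // ltW.
  by case: (Q) Q0 => // Q' _; rewrite exprS ler_piMr // exprn_ile1; lra.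
have [r r0 rP] := small_diam_few fewx.
have [e e0 eX] := compact_diam.
(* The first [k] letters shrink [X] below the scale [r], at the cost of a factor q^k. *)
have [k kP] : exists k, lam ^+ k * e < r.
  have : (fun k => lam ^+ k * e) @ \oo --> (0 : R) * e.
    apply: cvgM; last exact: cvg_cst.
    by apply: cvg_expr; rewrite ger0_norm // ltW.
  by rewrite mul0r => /cvgr_lt /(_ r r0) [k _ kP]; exists k; apply: kP => /=.
(* With as many blocks as the initial cost q^k, the product is at most t / 2^t, which is below 1. *)
pose t := (q ^ k)%N.
have t0 : (0 < t)%N by rewrite expn_gt0 card_alphabet_gt0.
exists (k + t * m)%N; first by rewrite addn_gt0 muln_gt0 t0 m0 orbT.
exists (q ^ k * P ^ t)%N.
  apply: few_cat (few_all mu X k) _ => u uk _.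
  apply: few_iter rP _ _ _ _ => [_ [x Xx <-]|_ _ [x Xx <-] [y Xy <-]].
    exact: Phi_X.
  rewrite (le_lt_trans (norm_Phi b lam0 hlam _ _ _)) // uk (le_lt_trans _ kP) //.
  by rewrite ler_wpM2l ?exprn_ge0 ?ltW // eX.
rewrite natrM exprD mulrACA (mulnC t m) exprM (natrX R P t) -(exprMn t).
have PL0 : 0 <= P%:R * lam ^+ m by rewrite mulr_ge0 // exprn_ge0 // ltW.
apply: (@le_lt_trans _ _ (t%:R * (1 / 2) ^+ t)).
  apply: ler_pM.
  - by rewrite mulr_ge0 // exprn_ge0 // ltW.
  - exact: exprn_ge0.
  - by rewrite ler_piMr // exprn_ile1 // ltW.
  - by apply: lerXn2r => //; rewrite nnegrE //; lra.
rewrite mul1r exprVn ltr_pdivrMr ?exprn_gt0 // mul1r -natrX ltr_nat.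
exact: ltn_expl.
Qed.

End Space.

End WordCount.

(** * The exceptional set of parameters *)

Section BadSet.
Context {R : realType} {d l : nat}.
Variables (Lam : alphabet l -> 'M[R]_d) (b : alphabet l -> 'cV[R]_d).
Variable v : 'I_l -> 'cV[R]_d.
Variables (N : 'cV[R]_d -> R) (lam : R).
Hypotheses (l0 : (0 < l)%N).
Hypotheses (hN : is_norm N) (lam0 : 0 < lam) (lam1 : lam < 1).
Hypothesis hlam : forall i x, N (Lam i *m x) <= lam * N x.
Variable X : set 'cV[R]_d.
Hypothesis cX : compact X.
Hypothesis hX : forall i x, X x -> X (phi Lam b i x).
Implicit Types (w : seq (alphabet l)) (x y : 'cV[R]_d) (mu : 'I_l -> R).

Local Notation Phi := (Phi Lam b).
Local Notation real := (real Lam b v).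

Definition bad : set ('I_l -> R) := [set mu | forall n, exists w,
  [/\ size w = n, exists2 x, X x & real mu w x &
      exists j, exists2 y, X y & dotv (v j) (Phi w y) = mu j]].

Fixpoint catpow (s : seq (seq (alphabet l))) k :=
  if k is k'.+1 then [seq u ++ w | u <- s, w <- catpow s k'] else [:: [::]].

Lemma size_catpow s k : size (catpow s k) = (size s ^ k)%N.
Proof. by elim: k => //= k IH; rewrite size_allpairs IH expnS. Qed.

Lemma mem_catpow mu n s :
  (forall w x, size w = n -> X x -> real mu w x -> w \in s) ->
  forall k w x, size w = (k * n)%N -> X x -> real mu w x -> w \in catpow s k.
Proof.
move=> sP; elim=> [|k IH] w x; first by move=> /size0nil ->; rewrite inE.
move=> wkn Xx; rewrite -(cat_take_drop n w) real_cat => -[r1 r2].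
have tn : size (take n w) = n by rewrite size_takel // wkn leq_addr.
apply/allpairsP; exists (take n w, drop n w); split => //=.
  exact: sP tn Xx r1.
by apply: IH r2; [rewrite size_drop wkn mulSn addKn | exact: Phi_X].
Qed.

(** Near [mu0] the realized words of length k n lie in a list of at most p^k words. If [Phi w X]
    meets [H_j], then [mu j] is within O(lam^(k n)) of the value at [x0], so boxes of total volume
    O((p lam^n)^k) suffice. *)
Lemma null_bad_near mu0 : generic Lam b v mu0 -> exists2 e : R, 0 < e &
  forall a a', (forall j, a j <= a' j <= a j + 1) ->
    (forall mu, box a a' mu -> forall j, `|mu j - mu0 j| < e) ->
    lebesgue_null (bad `&` box a a').
Proof.
move=> gmu; have [n n0 [p [s sp sP] plam]] := few_subexp hN lam0 lam1 hlam cX hX gmu.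
have [e [He e0]] := filter_ex (filterI
  (near_params b v hN lam0 lam1 hlam cX mu0 n) (nbhs_right_gt 0)).
exists e => // a a' aa' near0.
have [[x0 Xx0]|X0] := pselect (X !=set0); last first.
  apply: (@lebesgue_null_sub _ _ _ set0); last exact: lebesgue_null0.
  move=> mu [badmu _]; have [w [_ [x Xx _] _]] := badmu 0%N.
  by apply: X0; exists x.
have [D D0 XD] := compact_diam hN cX.
have /choice [C CP] : forall j, exists C, 0 <= C /\ forall x, `|dotv (v j) x| <= C * N x.
  by move=> j; have [C C0 CP] := dotv_bound hN (v j); exists C.
pose C1 := \sum_j C j.
have CC1 j : C j <= C1.
  by rewrite /C1 (bigD1 j) //= lerDl sumr_ge0 // => i _; case: (CP i).
have C10 : 0 <= C1 by apply: sumr_ge0 => j _; case: (CP j).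
apply: lebesgue_null_fin => // eps eps0.
have [k kP] : exists k, 2 * l%:R * C1 * D * (p%:R * lam ^+ n) ^+ k < eps.
  have : (fun k => 2 * l%:R * C1 * D * (p%:R * lam ^+ n) ^+ k) @ \oo -->
      2 * l%:R * C1 * D * 0.
    apply: cvgM; first exact: cvg_cst.
    by apply: cvg_expr; rewrite ger0_norm // mulr_ge0 // exprn_ge0 // ltW.
  by rewrite mulr0 => /cvgr_lt /(_ eps eps0) [k _ kP]; exists k; apply: kP => /=.
pose S := catpow s k.
pose r := C1 * (lam ^+ (k * n) * D).
have r0 : 0 <= r by rewrite mulr_ge0 // mulr_ge0 ?exprn_ge0 // ltW.
pose c (i : 'I_(size S) * 'I_l) := dotv (v i.2) (Phi (nth [::] S i.1) x0).
exists ('I_(size S) * 'I_l)%type,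
  (fun i j => if j == i.2 then c i - r else a j),
  (fun i j => if j == i.2 then c i + r else a' j); split.
- by move=> i j; case: ifP => _; [lra | case/andP: (aa' j)].
- move=> mu [badmu muB]; have [w [wkn [x Xx rw] [j [y Xy yH]]]] := badmu (k * n)%N.
  have wS : w \in S.
    apply: mem_catpow wkn Xx rw => w' x' w'n Xx' rw'.
    have [z Xz rz] := He mu w' x' (near0 mu muB) w'n Xx' rw'.
    exact: sP w'n Xz rz.
  have iS : (index w S < size S)%N by rewrite index_mem.
  exists (Ordinal iS, j) => // j' /=; case: eqP => [->|_]; last exact: muB.
  rewrite /c /= nth_index // -yH -ler_distl -dotvB (le_trans ((CP j).2 _)) //.
  apply: ler_pM => //; [exact: (CP j).1 | exact: norm_ge0 | ].
  rewrite (le_trans (norm_Phi b lam0 hlam _ _ _)) // wkn.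
  by rewrite ler_wpM2l ?exprn_ge0 ?ltW // XD.
- apply: (@le_trans _ _ (\sum_(i : 'I_(size S) * 'I_l) (2 * r))).
    apply: ler_sum => i _; rewrite /box_vol (bigD1 i.2) //= eqxx.
    rewrite (_ : c i + r - _ = 2 * r); last by ring.
    (* The sides in the other directions have length at most 1. *)
    apply: ler_piMr; first exact: mulr_ge0.
    apply: prodr_ile1 => j ji.
    by rewrite (negbTE ji); have := aa' j; lra.
  apply: le_trans (ltW kP).
  rewrite sumr_const card_prod !card_ord size_catpow -(mulr_natl (2 * r)) natrM natrX.
  rewrite exprMn.
  rewrite [leRHS](_ : _ = p%:R ^+ k * (l%:R * (2 * (C1 * ((lam ^+ n) ^+ k * D))))); last by ring.
  rewrite /r (mulnC k) exprM -mulrA ler_wpM2r //.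
    by rewrite mulr_ge0 // -exprM mulnC mulr_ge0.
  by rewrite lerXn2r // ?nnegrE // ler_nat.
Qed.

(** The cubical grids of mesh 1/(M+1) have countably many cells in all; a generic [mu] lies in a
    cell small enough for [null_bad_near]. *)
Lemma lebesgue_null_bad : lebesgue_null bad.
Proof.
pose grid (t : nat * {ffun 'I_l -> int}) : set ('I_l -> R) :=
  box (fun j => (t.2 j)%:~R / t.1.+1%:R) (fun j => ((t.2 j)%:~R + 1) / t.1.+1%:R).
(* Cells where nullity fails are replaced by the empty set, so every member is null; [None] stands
   for the nongeneric parameters. *)
pose F (o : option (nat * {ffun 'I_l -> int})%type) : set ('I_l -> R) :=
  if o is Some t then
    if pselect (lebesgue_null (bad `&` grid t)) then bad `&` grid t else set0
  else [set mu | ~ generic Lam b v mu].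
apply: (@lebesgue_null_sub _ _ _ (\bigcup_o F o)); last first.
  apply: lebesgue_null_bigcup_count => // -[t|] /=.
    by case: pselect => [p|_] /=; [exact: p | exact: lebesgue_null0].
  exact: lebesgue_null_nongeneric.
move=> mu badmu; have [gmu|] := pselect (generic Lam b v mu); last by exists None.
have [e e0 eP] := null_bad_near gmu.
pose M := Num.bound e^-1.
have M0 : 0 < M.+1%:R :> R by rewrite ltr0n.
have Me : M.+1%:R^-1 < e.
  rewrite invf_plt ?posrE // (lt_le_trans (archi_boundP _)) ?invr_ge0 ?(ltW e0) //.
  by rewrite ler_nat.
pose z : {ffun 'I_l -> int} := [ffun j => Num.floor (mu j * M.+1%:R)].
have gridmu : grid (M, z) mu.
  move=> j; rewrite /= ffunE ler_pdivrMr // ler_pdivlMr //.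
  by rewrite floor_le_tmp ltW // -intrD1 floorD1_gt.
exists (Some (M, z)) => //=; case: pselect => //; case; apply: eP => [j|mu' mu'B j] /=.
  rewrite mulrDl lerDl mul1r invr_ge0 (ltW M0) lerD2l invf_le1 //.
  by rewrite ler1n.
have := mu'B j; have := gridmu j; rewrite /= mulrDl mul1r.
move: Me; move: (M.+1%:R^-1) ((z j)%:~R / _) => B A Be.
by rewrite ltr_norml => *; apply/andP; split; lra.
Qed.

End BadSet.

(** * Asymptotic periodicity *)

Section Dynamics.
Context {R : realType} {d l : nat}.
Variables (Lam : alphabet l -> 'M[R]_d) (b : alphabet l -> 'cV[R]_d).
Variable v : 'I_l -> 'cV[R]_d.
Variables (N : 'cV[R]_d -> R) (lam : R).
Hypotheses (hN : is_norm N) (lam0 : 0 < lam) (lam1 : lam < 1).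
Hypothesis hlam : forall i x, N (Lam i *m x) <= lam * N x.
Implicit Types (w : seq (alphabet l)) (x y z : 'cV[R]_d) (k m p : nat).
Variable mu : 'I_l -> R.

Local Notation Phi := (Phi Lam b).
Local Notation real := (real Lam b v mu).
Local Notation f := (fmu Lam b v mu).

Lemma nbhs_norm x (B : set 'cV[R]_d) : nbhs x B ->
  exists2 e : R, 0 < e & forall y, N (y - x) < e -> B y.
Proof.
have [C C0 CN] := norm_lower hN.
move=> /nbhs_ballP [e /= e0 eB]; exists (e / C) => [|y]; first exact: divr_gt0.
rewrite ltr_pdivlMr // mulrC => ye; apply: eB; rewrite -ball_normE /= distrC.
exact: le_lt_trans (CN _) ye.
Qed.

Lemma lam_small (C e : R) : 0 < e -> exists K, forall k, (K <= k)%N -> C * lam ^+ k < e.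
Proof.
move=> e0; have : (fun k => C * lam ^+ k) @ \oo --> C * 0.
  apply: cvgM; first exact: cvg_cst.
  by apply: cvg_expr; rewrite ger0_norm // ltW.
by rewrite mulr0 => /cvgr_lt /(_ e e0) [K _ KP]; exists K => k; exact: KP.
Qed.

Lemma iter_periodic z p i : iter p f z = z -> iter (i * p) f z = z.
Proof. by move=> pz; elim: i => // i IH; rewrite mulSn iterD IH. Qed.

(** The orbit of [x] approaches that of [z] in phase, and the latter is finite, hence closed. *)
Lemma omega_limit_tracking x z M p (C : R) : (0 < p)%N -> iter p f z = z ->
  (forall i, N (iter (M + i) f x - iter i f z) <= C * lam ^+ i) ->
  omega_limit f x = orbit_set f z.
Proof.
move=> p0 pz track; apply/seteqP; split=> [q qw|_ [a _ <-] m m1 B].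
- apply: contrapT => nq.
  have fO : finite_set (orbit_set f z).
    apply: (@sub_finite_set _ _ ((fun i => iter i f z) @` `I_p)).
      move=> _ [i _ <-]; exists (i %% p)%N; first exact: ltn_pmod.
      by rewrite {2}(divn_eq i p) addnC iterD iter_periodic.
    exact/finite_image/finite_II.
  have cO : closed (orbit_set f z).
    exact: (accessible_finite_set_closed.1 (hausdorff_accessible (@norm_hausdorff _ _))).
  have [e e0 eO] : exists2 e : R, 0 < e & forall y, N (y - q) < e -> ~ orbit_set f z y.
    apply: (@nbhs_norm q (~` orbit_set f z)); apply: open_nbhs_nbhs.
    by split=> //; exact: closed_openC.
  have [K KP] := lam_small C (divr_gt0 e0 (ltr0Sn R 1)).
  have [_ /= [[n Mn <-] nq']] := qw (M + K).+1 isT _ (near_norm hN q (divr_gt0 e0 (ltr0Sn R 1))).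
  have Mn' : (M + K <= n)%N := ltnW Mn.
  have nE : n = (M + (n - M))%N by rewrite subnKC // (leq_trans _ Mn') ?leq_addr.
  have Ki : (K <= n - M)%N by rewrite leq_subRL // (leq_trans _ Mn') ?leq_addr.
  apply: (eO (iter (n - M) f z)); last by exists (n - M)%N.
  have := norm_dist_trans hN (iter n f x) (iter (n - M) f z) q.
  have := track (n - M)%N; rewrite -nE (norm_distC hN) => h1 h2.
  by have := KP _ Ki; lra.
- move=> /nbhs_norm [e e0 eB]; have [K KP] := lam_small C e0.
  (* A time congruent to [a] modulo [p] and at least [m + K]. *)
  pose i := (a + (m + K) * p)%N.
  have mKi : (m + K <= i)%N.
    by rewrite (leq_trans _ (leq_addl _ _)) // leq_pmulr.
  exists (iter (M + i) f x); split.
    exists (M + i)%N => //=.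
    by rewrite (leq_trans _ (leq_addl _ _)) // (leq_trans _ mKi) ?leq_addr.
  have iz : iter i f z = iter a f z by rewrite /i iterD iter_periodic.
  apply: eB; rewrite -iz; apply: le_lt_trans (track i) _.
  by apply: KP; rewrite (leq_trans _ mKi) ?leq_addl.
Qed.

Lemma fixpoint_exists (M : 'M[R]_d) (c : 'cV[R]_d) :
  (forall x, M *m x = x -> x = 0) -> exists z, M *m z + c = z.
Proof.
move=> M1; have U : 1%:M - M \in unitmx.
  (* [kermx] is a left kernel; its rows, transposed, are fixed vectors of [M]. *)
  rewrite -unitmx_tr -row_free_unit -kermx_eq0; apply/eqP/row_matrixP => i.
  apply: trmx_inj; rewrite row0 trmx0; apply: M1.
  apply/esym/eqP; rewrite -subr_eq0 -[X in X - _]mul1mx -mulmxBl.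
  by apply/eqP/trmx_inj; rewrite trmx_mul trmxK -row_mul mulmx_ker row0 trmx0.
exists (invmx (1%:M - M) *m c).
have := mulKVmx U c; rewrite mulmxBl mul1mx => E.
by rewrite -[X in _ + X]E addrC subrK.
Qed.

Variable X : set 'cV[R]_d.
Hypothesis cX : compact X.
Hypothesis hX : forall i x, X x -> X (phi Lam b i x).
Hypothesis convX : forall x y (t : R), 0 <= t <= 1 -> X x -> X y ->
  X ((1 - t) *: x + t *: y).
Variable n : nat.
Hypothesis sep : forall w, size w = n -> (exists2 x, X x & real w x) ->
  forall j y, X y -> dotv (v j) (Phi w y) <> mu j.

(** * Itineraries and limit cycles *)

Fixpoint code k x : seq (alphabet l) :=
  if k is k'.+1 then label v mu x :: code k' (f x) else [::].

Lemma size_code k x : size (code k x) = k.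
Proof. by elim: k x => //= k IH x; rewrite IH. Qed.

Lemma iter_code k x : iter k f x = Phi (code k x) x.
Proof. by elim: k x => // k IH x; rewrite iterSr IH. Qed.

Lemma real_code k x : real (code k x) x.
Proof. by elim: k x => //= k IH x; split; [exact: compat_label | exact: IH]. Qed.

Lemma code_add k m x : code (k + m) x = code k x ++ code m (iter k f x).
Proof. by elim: k x => // k IH x; rewrite addSn /= IH -iterSr. Qed.

Lemma iter_X k x : X x -> X (iter k f x).
Proof. by move=> Xx; rewrite iter_code; exact: Phi_X. Qed.

(** [X] is convex and [Phi w] affine: if two labels differed, a segment inside the image of [X]
    would meet a hyperplane, against [sep]. *)
Lemma label_const x y z : X x -> X y -> X z ->
  label v mu (Phi (code n x) y) = label v mu (Phi (code n x) z).
Proof.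
move=> Xx.
suff half y' z' j : X y' -> X z' -> mu j < dotv (v j) (Phi (code n x) y') ->
    mu j < dotv (v j) (Phi (code n x) z').
  by move=> Xy Xz; apply/ffunP => j; rewrite !ffunE; apply/idP/idP; exact: half.
move=> Xy Xz; set A := dotv _ _; set B := dotv _ _ => muA.
rewrite ltNge; apply/negP => Bmu.
have AB : 0 < A - B by lra.
(* The point of the segment where the linear form equals [mu j]. *)
pose t := (A - mu j) / (A - B).
have t01 : 0 <= t <= 1.
  by rewrite divr_ge0 ?ler_pdivrMr ?mul1r //=; lra.
case: (sep (size_code n x) (ex_intro2 _ _ x Xx (real_code n x))
  (j := j) (convX t01 Xy Xz)).
rewrite dotv_Phi mulmxDr -!scalemxAr mxE [X in X + _ + _]mxE [X in _ + X + _]mxE.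
have := dotv_Phi Lam b v (code n x) j y'; have := dotv_Phi Lam b v (code n x) j z'.
rewrite -/A -/B; move: ((_ *m z') 0 0) ((_ *m y') 0 0) (dotv _ _) => p q c EB EA.
have -> : q = A - c by lra.
have -> : p = B - c by lra.
by rewrite /t; field; lra.
Qed.

(** Any [n] consecutive labels determine the next one, so equality of codes passes to the images
    under [f]. *)
Lemma code_eqS x y : X x -> X y -> code n x = code n y ->
  label v mu x = label v mu y /\ code n (f x) = code n (f y).
Proof.
move=> Xx Xy xy.
have : code (n + 1) x = code (n + 1) y.
  rewrite !code_add xy /= (iter_code n x) (iter_code n y) xy.
  by rewrite (label_const Xy Xx Xy).
by rewrite addn1 => -[].
Qed.

Lemma code_eq x y : X x -> X y -> code n x = code n y ->
  forall k, code k x = code k y.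
Proof.
move=> + + + k; elim: k x y => // k IH x y Xx Xy xy /=.
have [-> fxy] := code_eqS Xx Xy xy; congr (_ :: _).
by apply: IH fxy; exact: hX.
Qed.

(** Pigeonhole on the finitely many words of length [n]. *)
Lemma code_recurs x : exists m p, (0 < p)%N /\
  code n (iter m f x) = code n (iter p f (iter m f x)).
Proof.
pose T := n.-tuple (alphabet l).
have sz i : size (code n (iter i f x)) == n by rewrite size_code.
pose g (i : 'I_(#|{: T}|.+1)) : T := Tuple (sz i).
have : ~~ injectiveb g.
  by apply/negP => /injectiveP /leq_card; rewrite card_ord ltnn.
move=> /injectivePn [i [j ij gij]].
have {gij} : code n (iter i f x) = code n (iter j f x) by case: gij.
wlog ltij : i j ij / (i < j)%N.
  have [ltij|ltji|/val_inj eqij] := ltngtP i j; first exact.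
    by move=> /(_ j i) H /esym; apply: H => //; rewrite eq_sym.
  by rewrite eqij eqxx in ij.
move=> E; exists i, (j - i)%N; rewrite subn_gt0; split => //.
by rewrite -iterD subnK // ltnW.
Qed.

(* The limit cycle is found as the fixed point of the composition of the maps
   along one period of the itinerary; it has the same itinerary because it lies
   in the same sets [Phi w X], on which labels are constant. *)
Lemma limit_cycle x : X x -> exists z p M (C : R), [/\ (0 < p)%N, iter p f z = z &
  forall i, N (iter (M + i) f x - iter i f z) <= C * lam ^+ i].
Proof.
move=> Xx; have [m [p [p0 mp]]] := code_recurs x.
set y := iter m f x in mp; have Xy : X y := iter_X m Xx.
have code_p := code_eq Xy (iter_X p Xy) mp.
have [z uz] : exists z, Lin Lam (code p y) *m z + Phi (code p y) 0 = z.
  apply: fixpoint_exists => t Mt; case: hN => N0 _ _; apply: N0.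
  have := norm_Lin lam0 hlam (code p y) t; rewrite Mt size_code.
  have lp : lam ^+ p < 1 by rewrite exprn_ilt1 // -?lt0n // ltW.
  rewrite -subr_ge0 -[X in _ - X]mul1r -mulrBl nmulr_rge0 ?subr_lt0 // => t0.
  by apply/le_anti; rewrite t0 norm_ge0.
rewrite -Phi_linear in uz.
pose w k := Phi (code k y) z.
have wp j : w (j * p)%N = z.
  by rewrite /w; elim: j => // j IH; rewrite mulSn code_add -code_p Phi_cat uz.
have track k : N (iter k f y - w k) <= lam ^+ k * N (y - z).
  by rewrite iter_code /w (le_trans (norm_Phi b lam0 hlam _ _ _)) // size_code.
(* [z] is the limit of the iterates of [y] at multiples of [p], and [X] is closed. *)
have Xz : X z.
  have cl : closed X by apply: compact_closed => //; exact: norm_hausdorff.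
  rewrite ((closure_id X).1 cl) => B /nbhs_norm [e e0 eB].
  have [K KP] := lam_small (N (y - z)) e0.
  exists (iter (K * p) f y); split; first exact: iter_X.
  apply: eB; rewrite -[X in _ - X](wp K) (le_lt_trans (track _)) // mulrC.
  by apply: KP; rewrite leq_pmulr.
have Xw k : X (w k) by exact: Phi_X.
(* The shift by [n] matters: [label_const] compares labels only after [n] common letters. *)
have fw k : f (w (k + n)%N) = w (k + n).+1.
  have lbl : label v mu (w (k + n)%N) = label v mu (iter (k + n) f y).
    rewrite /w code_add Phi_cat (label_const (iter_X k Xy) (Xw k) (iter_X k Xy)).
    by rewrite -iter_code -iterD addnC.
  by rewrite /fmu lbl /w -[in RHS]addn1 (code_add (k + n) 1) Phi_cat.
(* Time [n * p] is at least [n], and a multiple of [p], where [w] returns to [z]. *)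
have iw i : iter i f z = w (n * p + i)%N.
  elim: i => [|i IH]; first by rewrite addn0 wp.
  have E : (n * p + i = (n * p - n + i) + n)%N by rewrite addnAC subnK ?leq_pmulr.
  by rewrite iterS IH E fw -E addnS.
exists z, p, (m + n * p)%N, (N (y - z)); split => // [|i].
  by rewrite iw addnC -mulSn wp.
have -> : iter (m + n * p + i) f x = iter (n * p + i) f y.
  by rewrite /y -iterD (addnC _ m) addnA.
rewrite iw (le_trans (track _)) // mulrC ler_wpM2l ?norm_ge0 //.
by rewrite ler_wiXn2l ?leq_addl // ltW.
Qed.

(** Points with the same first [n] letters share their whole itinerary, so the contraction brings
    their orbits together. *)
Lemma omega_limit_code (Y : set 'cV[R]_d) (t : n.-tuple (alphabet l)) : Y `<=` X ->
  exists zp : 'cV[R]_d * nat, (exists2 x, Y x & code n x = t) ->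
    [/\ (0 < zp.2)%N, iter zp.2 f zp.1 = zp.1 &
    forall x, Y x -> code n x = t -> omega_limit f x = orbit_set f zp.1].
Proof.
move=> YX; have [[x Yx xt]|nt] := pselect (exists2 x, Y x & code n x = t); last first.
  (* A dummy value for words coding no point of [Y]. *)
  by exists (0, 0%N) => /nt.
have [z [p [M [C [p0 pz track]]]]] := limit_cycle (YX _ Yx).
exists (z, p) => _; split => // y Yy yt.
have xy := code_eq (YX _ Yx) (YX _ Yy) (etrans xt (esym yt)).
apply: (@omega_limit_tracking y z M p (N (y - x) + C)) => // i.
have := norm_dist_trans hN (iter (M + i) f x) (iter (M + i) f y) (iter i f z).
move=> /le_trans; apply; rewrite mulrDl lerD //.
rewrite (iter_code _ x) (iter_code _ y) xy (le_trans (norm_Phi b lam0 hlam _ _ _)) //.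
by rewrite size_code mulrC ler_wpM2l ?norm_ge0 // ler_wiXn2l ?leq_addl // ltW.
Qed.

(** One cycle is listed for each of the finitely many words of length [n] coding a point of [Y];
    words may share a cycle. *)
Lemma asymptotically_periodic_sep (Y : set 'cV[R]_d) : Y `<=` X ->
  asymptotically_periodic f Y.
Proof.
move=> YX; have /choice [zp zpP] := fun t => omega_limit_code t YX.
pose P : pred (n.-tuple (alphabet l)) :=
  fun t => `[< exists2 x, Y x & code n x = t >].
have PP t : t \in P -> exists2 x, Y x & code n x = t by move=> /asboolP.
exists #|P|, (fun r => (zp (enum_val r)).1), (fun r => (zp (enum_val r)).2).
split=> [r|]; first by have [] := zpP _ (PP _ (enum_valP r)).
apply/seteqP; split=> q.
  move=> [x Yx qx]; have sx : size (code n x) == n by rewrite size_code.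
  have tP : Tuple sx \in P by apply/asboolP; exists x.
  exists (enum_rank_in tP (Tuple sx)) => //; rewrite enum_rankK_in //.
  by have [_ _ /(_ x Yx erefl) <-] := zpP _ (PP _ tP).
move=> [r _ qr]; have [x Yx xr] := PP _ (enum_valP r); exists x => //.
by have [_ _ /(_ x Yx xr) ->] := zpP _ (PP _ (enum_valP r)).
Qed.

End Dynamics.

(** * Convexity, a common contraction rate and the conclusion *)

Lemma Hpolyhedron_convex (R : realType) (d : nat) (X : set 'cV[R]_d) x y (t : R) :
  is_Hpolyhedron X -> 0 <= t <= 1 -> X x -> X y -> X ((1 - t) *: x + t *: y).
Proof.
move=> [m [a [beta ->]]] /andP[t0 t1] Xx Xy k.
rewrite dotvE mulmxDr -!scalemxAr mxE [X in X + _]mxE [X in _ + X]mxE -!dotvE.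
have -> : beta k = (1 - t) * beta k + t * beta k by ring.
by rewrite lerD // ler_wpM2l ?subr_ge0.
Qed.

(** A maximum over the finite alphabet, seeded with 1/2 so that the rate is positive. *)
Lemma common_contraction (R : realType) (d l : nat) (Lam : alphabet l -> 'M[R]_d)
    (N : 'cV[R]_d -> R) : is_norm N -> (forall i, op_norm N (Lam i) < 1) ->
  exists lam : R, [/\ 0 < lam, lam < 1 & forall i x, N (Lam i *m x) <= lam * N x].
Proof.
move=> hN L1; pose lam := \big[Num.max/2^-1]_i op_norm N (Lam i); exists lam; split.
- apply: lt_le_trans (_ : 2^-1 <= lam); first by rewrite invr_gt0.
  exact: bigmax_ge_id.
- apply: bigmax_lt => //; rewrite invf_lt1 //; lra.
- move=> i x; rewrite (le_trans (op_norm_bound hN _ _)) // ler_wpM2r ?norm_ge0 //.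
  exact: le_bigmax.
Qed.

Theorem theorem2p12 (R : realType) (d l : nat) (hl : (1 <= l)%N)
  (X : set 'cV[R]_d) (hXpoly : is_Hpolyhedron X) (hXcpt : compact X)
  (Lam : alphabet l -> 'M[R]_d) (b : alphabet l -> 'cV[R]_d)
  (hGL : forall i, Lam i \in unitmx)
  (N : 'cV[R]_d -> R) (hN : is_norm N)
  (hcontr : forall i, op_norm N (Lam i) < 1)
  (hinside : forall i, phi Lam b i @` X `<=` relint X)
  (v : 'I_l -> 'cV[R]_d) (hv : forall j, dotv (v j) (v j) = 1) :
  exists E : set ('I_l -> R), lebesgue_null E /\
    forall mu : 'I_l -> R, ~ E mu ->
      asymptotically_periodic (fmu Lam b v mu) (regular_set X Lam b v mu).
Proof.
have hX i x : X x -> X (phi Lam b i x).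
  by move=> Xx; have [] := hinside i _ (ex_intro2 _ _ x Xx erefl).
have [lam [lam0 lam1 hlam]] := common_contraction hN hcontr.
exists (bad Lam b v X); split.
  exact: (lebesgue_null_bad v hl hN lam0 lam1 hlam hXcpt hX).
(* Outside [bad], some length [n] has no realized word whose image of [X] meets a hyperplane; this
   is the hypothesis [sep]. *)
move=> mu /existsNP [n /forallNP nbad].
have convX x y t := @Hpolyhedron_convex R d X x y t hXpoly.
apply: (asymptotically_periodic_sep hN lam0 lam1 hlam hXcpt hX convX (n := n)).
  move=> w wn rw j y Xy E; apply: (nbad w); split => //.
  by exists j, y.
by move=> x [].
Qed.
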